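(* For every $p\in(0,1/2)$, every integer $d\ge 2$, and every probability measure $\nu$ on $\{0,1,2,\dots\}$, the number of root visits in the self-similar frog model on the $d$-ary tree is stochastically dominated by the number of root visits in the self-similar frog model on the $(d+1)$-ary tree: $$V_{\mathrm{SFM}(d,p,\nu)}\preceq V_{\mathrm{SFM}(d+1,p,\nu)}.$$
   Context: For random variables $X,Y$ with values in $[0,\infty]$, $X\preceq Y$ means that there is a coupling of $X$ and $Y$ with $X\le Y$ almost surely. Let $\mathbb T_d$ be the infinite rooted $d$-ary tree with root $\varnothing$ (every vertex has exactly $d$ children). For $p\in(0,1/2)$ set $$p_d^*=\frac{p(d-1)}{d-(d+1)p},\qquad \hat p=\frac{p}{1-p}.$$ The self-similar frog model $\mathrm{SFM}(d,p,\nu)$ is the following discrete-time process on $\mathbb T_d$. Initially there is one active particle (frog) at $\varnothing$, and the non-root vertices contain independent, identically $\nu$-distributed numbers of dormant particles. Active particles move independently, each along a non-backtracking path, as follows. - The initial particle moves in its first step to a uniformly sampled child of $\varnothing$. - A just-activated particle takes its first step toward the root (to the parent) with probability $p_d^*$, and otherwise moves to a uniformly sampled child. - For subsequent steps: if the particle's previous step was toward the root, then its next step is toward the root with probability $\hat p$, and otherwise it moves away from the root to a uniformly sampled child other than the one it just came from. If its previous step was away from the root, then all its subsequent steps are away from the root to uniformly sampled children. - When an active particle moves to a vertex not previously visited, all dormant particles there become active. - Any particle that moves to the root is killed there (this counts as a root visit) and no longer participates. - A particle that moves away from the root to a vertex that has already been visited is killed upon arriving there. If several active particles simultaneously attempt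 to move away from the root to the same unvisited vertex, then one of them (chosen uniformly at random) continues its path and the others are killed. $V_{\mathrm{SFM}(d,p,\nu)}\in\{0,1,2,\dots\}\cup\{\infty\}$ denotes the total number of visits to the root $\varnothing$ by particles in the process. *)

(* Defs.v *)
From HB Require Import structures.
From mathcomp Require Import all_boot all_order all_algebra.
From mathcomp Require Import all_classical all_reals all_analysis.
From mathcomp Require Import measurable_realfun.

Set Implicit Arguments.
Unset Strict Implicit.
Unset Printing Implicit Defensive.

Import Order.TTheory GRing.Theory Num.Theory.

Local Open Scope classical_set_scope.
Local Open Scope ring_scope.

(* X and Y may live on different probability spaces; a coupling is a pair of
   random variables on a common space with the same marginal laws. *)
Definition stoch_le (R : realType)
    (d1 d2 : measure_display) (T1 : measurableType d1) (T2 : measurableType d2)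
    (P1 : probability T1 R) (P2 : probability T2 R)
    (X : {RV P1 >-> \bar R}) (Y : {RV P2 >-> \bar R}) : Prop :=
  exists (d : measure_display) (T : measurableType d) (P : probability T R)
         (X' Y' : {RV P >-> \bar R}),
    [/\ forall B, measurable B -> distribution P X' B = distribution P1 X B,
        forall B, measurable B -> distribution P Y' B = distribution P2 Y B
      & {ae P, forall t, (X' t <= Y' t)%E}].

(* Meant for a family G of sigma-algebras. *)
Definition mutually_independent (R : realType) (dT : measure_display)
    (T : measurableType dT) (P : probability T R)
    (I : Type) (G : I -> set (set T)) : Prop :=
  forall (n : nat) (J : 'I_n -> I) (A : 'I_n -> set T), injective J ->
    (forall k, G (J k) (A k)) ->
    P (\bigcap_(k in [set: 'I_n]) A k) = (\prod_(k < n) fine (P (A k)))%:E.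

(* The vertices of the rooted d-ary tree are the finite words over 'I_d,
   stored with the last letter first: the children of v are the words j :: v. *)
Definition vertex (d : nat) := seq 'I_d.

HB.instance Definition _ (d : nat) := Countable.copy (vertex d) (seq 'I_d).
HB.instance Definition _ (d : nat) := isPointed.Build (vertex d) [::].
HB.instance Definition _ (d : nat) :=
  @isMeasurable.Build default_measure_display (vertex d) discrete_measurable
    discrete_measurable0 discrete_measurableC discrete_measurableU.

Definition root {d : nat} : vertex d := [::].

(* By convention, parent root = root. *)
Definition parent {d : nat} (v : vertex d) : vertex d := behead v.

Definition is_child {d : nat} (v x : vertex d) : bool :=
  (x != root) && (parent x == v).

Definition pstar (R : realType) (d : nat) (p : R) : R :=
  p * (d%:R - 1) / (d%:R - (d%:R + 1) * p).

Definition phat (R : realType) (p : R) : R := p / (1 - p).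

(* Probability that a particle at v moves to x, where prev is the vertex it
   occupied one step earlier (None if it has just been activated).  Only the
   initial particle is activated at the root.  A walk only matters until it
   returns to the root, where the particle is killed; by convention it then
   stays there. *)
Definition step_prob (R : realType) (d : nat) (p : R)
    (prev : option (vertex d)) (v x : vertex d) : R :=
  match prev with
  | None =>
      if v == root then (if is_child v x then d%:R^-1 else 0)
      else if x == parent v then pstar d p
      else if is_child v x then (1 - pstar d p) / d%:R else 0
  | Some u =>
      if v == root then (x == root)%:R
      else if v == parent u then
        if x == parent v then phat p
        else if is_child v x && (x != u) then (1 - phat p) / (d%:R - 1) else 0
      else if is_child v x then d%:R^-1 else 0
  end.

(* Probability that a particle activated at v visits x 0, ..., x n in order. *)
Definition walk_prob (R : realType) (d : nat) (p : R) (v : vertex d)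
    (x : nat -> vertex d) (n : nat) : R :=
  (x 0%N == v)%:R *
  \prod_(0 <= k < n)
     step_prob p (if k is k'.+1 then Some (x k') else None) (x k) (x k.+1).

(* (v, i) is the i-th particle initially located at v; the initial active
   particle is (root, 0). *)
Definition frog (d : nat) : Type := (vertex d * nat)%type.

Inductive source (d : nat) : Type :=
  | Sleepers of vertex d
  | Walk of frog d
  | Tie of vertex d & nat.

Definition source_sigma (d : nat) (dT : measure_display)
    (T : measurableType dT) (sleepers : vertex d -> T -> nat)
    (walk : frog d -> nat -> T -> vertex d) (tie : vertex d -> nat -> T -> nat)
    (s : source d) : set (set T) :=
  match s with
  | Sleepers v => g_sigma_algebra_preimage (sleepers v)
  | Walk f => <<s \bigcup_n g_sigma_algebra_preimage (walk f n) >>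
  | Tie x m => g_sigma_algebra_preimage (tie x m)
  end.

(* The randomness of the model on a probability space:
   - sleepers v is the number of particles dormant at v (unused at the root);
   - walk f n is the position of the particle f after the n steps that follow
     its activation, assuming that it has not been killed by then;
   - tie x m is the rank of the surviving particle when m particles attempt
     to move away from the root to the unvisited vertex x at the same time. *)
Record SFM (R : realType) (d : nat) (p : R) (nu : probability nat R)
    (dT : measure_display) (T : measurableType dT) (P : probability T R) := {
  sleepers : vertex d -> {RV P >-> nat};
  walk : frog d -> nat -> {RV P >-> vertex d};
  tie : vertex d -> nat -> {RV P >-> nat};
  sleepers_law : forall v B, distribution P (sleepers v) B = nu B;
  walk_law : forall (f : frog d) (x : nat -> vertex d) n,
    P [set t | forall k, (k <= n)%N -> walk f k t = x k]
      = (walk_prob p f.1 x n)%:E;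
  tie_law : forall x m i, (i < m)%N ->
    distribution P (tie x m) [set i] = (m%:R^-1)%:E;
  source_indep : mutually_independent P
    (source_sigma sleepers walk tie)
}.

(* The (deterministic) evolution of the process once the randomness is fixed. *)
Section Dynamics.
Context (d : nat).
Variables (eta : vertex d -> nat) (w : frog d -> nat -> vertex d)
          (rank : vertex d -> nat -> nat).

(* The list of visited vertices, and the list of the live active particles,
   each with the number of steps it has made since its activation. *)
Definition state : Type := (seq (vertex d) * seq (frog d * nat))%type.

Implicit Types (s : state) (a : frog d * nat).

Definition position a : vertex d := w a.1 a.2.
Definition target a : vertex d := w a.1 a.2.+1.
Definition inward a : bool := target a == parent (position a).

Definition arrivals s : nat := count (fun a => target a == root) s.2.

(* The surviving contender is chosen by its rank in this list. *)
Definition contenders s (x : vertex d) : seq (frog d * nat) :=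
  [seq a <- s.2 | ~~ inward a & target a == x].

Definition survives s a : bool :=
  (target a != root) &&
  (inward a ||
   (target a \notin s.1) &&
   (index a (contenders s (target a))
      == rank (target a) (size (contenders s (target a))))).

Definition newly_visited s : seq (vertex d) :=
  undup [seq x <- [seq target a | a <- s.2 & survives s a] | x \notin s.1].

Definition step s : state :=
  (newly_visited s ++ s.1,
   [seq (a.1, a.2.+1) | a <- s.2 & survives s a] ++
   [seq ((v, i), 0%N) | v <- newly_visited s, i <- iota 0 (eta v)]).

Definition state_at (n : nat) : state :=
  iter n step ([:: root], [:: ((root, 0%N), 0%N)]).

End Dynamics.

Section Visits.
Context (R : realType) (d : nat) (p : R) (nu : probability nat R)
  (dT : measure_display) (T : measurableType dT) (P : probability T R).
Variable X : SFM d p nu P.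

Definition sfm_state (n : nat) (t : T) : state d :=
  state_at (fun v => sleepers X v t) (fun f k => walk X f k t)
    (fun x m => tie X x m t) n.

Definition sfm_arrivals (n : nat) (t : T) : nat :=
  arrivals (fun f k => walk X f k t) (sfm_state n t).

Definition root_visits (t : T) : \bar R :=
  (\sum_(0 <= n <oo) (sfm_arrivals n t)%:R%:E)%E.

(* For countable C, dmeas f says that f is measurable for the discrete
   sigma-algebra on C. *)
Let dmeas (C : Type) (f : T -> C) := forall c, measurable (f @^-1` [set c]).

Let dmeas_bind (C : countType) (C' : Type) (f : T -> C) (g : C -> T -> C') :
  dmeas f -> (forall c, dmeas (g c)) -> dmeas (fun t => g (f t) t).
Proof.
move=> mf mg c'.
rewrite (_ : _ @^-1` _ =
    \bigcup_(c in [set: C]) (f @^-1` [set c] `&` g c @^-1` [set c'])).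
  apply: countable_bigcupT_measurable => [|c]; first exact: countableP.
  by apply: measurableI; [exact: mf|exact: mg].
by apply/seteqP; split => t /=; [move=> <-; exists (f t)|move=> [c _ [<-]]].
Qed.

Let dmeas_cst (C : Type) (c : C) : dmeas (fun=> c).
Proof.
move=> c'; have [->|ne] := pselect (c = c').
  by rewrite (_ : _ @^-1` _ = setT)//; apply/seteqP; split.
by rewrite (_ : _ @^-1` _ = set0)//; apply/seteqP; split.
Qed.

Let dmeas_comp (C : countType) (C' : Type) (f : T -> C) (h : C -> C') :
  dmeas f -> dmeas (fun t => h (f t)).
Proof. by move=> mf; apply: (@dmeas_bind C C' f (fun c _ => h c)). Qed.

Let dmeas2 (C1 C2 : countType) (C' : Type) (f : T -> C1) (g : T -> C2)
    (h : C1 -> C2 -> C') :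
  dmeas f -> dmeas g -> dmeas (fun t => h (f t) (g t)).
Proof.
move=> mf mg; apply: (@dmeas_bind C1 C' f (fun c t => h c (g t))) => // c.
exact: dmeas_comp.
Qed.

Let dmeas_filter (A : countType) (b : A -> T -> bool) (s : seq A) :
  (forall a, dmeas (b a)) -> dmeas (fun t => [seq a <- s | b a t]).
Proof.
move=> mb; elim: s => [|a s IH] /=; first exact: dmeas_cst.
exact: (dmeas2 (fun (c : bool) r => if c then a :: r else r)).
Qed.

Let dmeas_map (A C : countType) (g : A -> T -> C) (s : seq A) :
  (forall a, dmeas (g a)) -> dmeas (fun t => [seq g a t | a <- s]).
Proof.
move=> mg; elim: s => [|a s IH] /=; first exact: dmeas_cst.
exact: (dmeas2 (@cons C)).
Qed.

Let dmeas_rv (dC : measure_display) (U : measurableType dC)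
    (f : {RV P >-> U}) : (forall u : U, measurable [set u]) -> dmeas f.
Proof.
by move=> mU u; rewrite -[X in measurable X]setTI; exact: measurable_funPT.
Qed.

Let W t f k := walk X f k t.
Let E t v := sleepers X v t.
Let K t x m := tie X x m t.

Let dmeas_target a : dmeas (fun t => target (W t) a).
Proof. by apply: (@dmeas_rv _ (vertex d) (walk X a.1 a.2.+1)). Qed.

Let dmeas_inward a : dmeas (fun t => inward (W t) a).
Proof. by apply: (dmeas2 (fun x y => x == parent y)); exact: dmeas_rv. Qed.

Let dmeas_contenders s x : dmeas (fun t => contenders (W t) s x).
Proof.
apply: dmeas_filter => a.
apply: (dmeas2 (fun b y => ~~ b && (y == x))) => //.
Qed.

Let dmeas_survives s a : dmeas (fun t => survives (W t) (K t) s a).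
Proof.
apply: (dmeas_bind (g := fun x t => (x != root) && (inward (W t) a ||
  (x \notin s.1) && (index a (contenders (W t) s x)
      == K t x (size (contenders (W t) s x)))))) => // x.
apply: (dmeas2 (fun b c => (x != root) && (b || (x \notin s.1) && c))) => //.
apply: (dmeas_bind (g := fun c t => index a c == K t x (size c))) => // c.
by apply: dmeas_comp; exact: dmeas_rv.
Qed.

Let dmeas_survivors s : dmeas (fun t => [seq a <- s.2 | survives (W t) (K t) s a]).
Proof. exact: dmeas_filter. Qed.

Let dmeas_newly s : dmeas (fun t => newly_visited (W t) (K t) s).
Proof.
apply: (dmeas_bind (g := fun r t =>
  undup [seq x <- [seq target (W t) a | a <- r] | x \notin s.1])) => // r.
by apply: (dmeas_comp (fun l => undup [seq x <- l | x \notin s.1]));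
  exact: dmeas_map.
Qed.

Let dmeas_step s : dmeas (fun t => step (E t) (W t) (K t) s).
Proof.
apply: (dmeas_bind (g := fun l t => (l ++ s.1,
   [seq (a.1, a.2.+1) | a <- s.2 & survives (W t) (K t) s a] ++
   [seq ((v, i), 0%N) | v <- l, i <- iota 0 (E t v)]))) => // l.
apply: (dmeas2 (fun r q => (l ++ s.1, [seq (a.1, a.2.+1) | a <- r] ++ q))) => //.
apply: (dmeas_comp flatten); apply: dmeas_map => v.
apply: (dmeas_comp (fun n => [seq ((v, i), 0%N) | i <- iota 0 n])).
exact: dmeas_rv.
Qed.

Let dmeas_state n : dmeas (sfm_state n).
Proof.
elim: n => [|n IH]; first exact: dmeas_cst.
exact: (dmeas_bind (g := fun s t => step (E t) (W t) (K t) s)).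
Qed.

Let dmeas_arrivals n : dmeas (sfm_arrivals n).
Proof.
apply: (dmeas_bind (g := fun s t => arrivals (W t) s)) => // s.
rewrite (_ : (fun t => _) =
  fun t => count (pred1 root) [seq target (W t) a | a <- s.2]).
  by apply: dmeas_comp; exact: dmeas_map.
by apply/funext => t; rewrite count_map.
Qed.

Lemma measurable_root_visits : measurable_fun [set: T] root_visits.
Proof.
apply: ge0_emeasurable_sum => [n t _ _|n _]; first by rewrite lee_fin.
move=> _ B _; rewrite setTI.
rewrite (_ : _ @^-1` B =
  \bigcup_(c in [set c : nat | B (c%:R%:E)]) (sfm_arrivals n @^-1` [set c])).
  by apply: bigcup_measurable => c _; exact: dmeas_arrivals.
by apply/seteqP; split => t /=; [move=> Bt; exists (sfm_arrivals n t)
  |move=> [c Bc /= ->]].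
Qed.

HB.instance Definition _ :=
  isMeasurableFun.Build _ _ T (\bar R) root_visits measurable_root_visits.

Definition V_SFM : {RV P >-> \bar R} := root_visits.

End Visits.

(* Main.v *)
Require Import Defs.
From HB Require Import structures.
From mathcomp Require Import all_boot all_order all_algebra.
From mathcomp Require Import all_classical all_reals all_analysis.
From mathcomp Require Import measurable_realfun ring lra zify.

(* Only the positions of the particles matter, not their names, and then the
   moves of any two particles commute in law: if both are about to enter the same
   unvisited vertex, exactly one of them survives, whoever comes first.  So moving
   a particle early never hurts, and on the (d+1)-ary tree the best probability
   bestE n of at least m root visits that can be achieved by moving one particle
   at a time, at most n times, in an order of one's choice, is at most the
   probability of at least m visits within n steps of the process.

   The limit supE of bestE n is superharmonic for the moves on the (d+1)-ary
   tree.  The d-ary tree sits in the (d+1)-ary one, and supE is superharmonic for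
   the moves on the d-ary tree too: unvisited children of a vertex are
   exchangeable, killing a particle is never better than sending it to its parent
   or to an unvisited child, and once a child of the current vertex has been
   visited, passing from d to d+1 decreases the probability to be killed and no
   other one.  A newly activated particle finds such a child if the particle that
   activated it moves first.  Hence supE at the initial configuration lies between
   the two tail probabilities; tails ordered in this way are coupled through
   their quantile functions. *)

Set Implicit Arguments.
Unset Strict Implicit.
Unset Printing Implicit Defensive.

Import Order.TTheory GRing.Theory Num.Theory.

Local Open Scope classical_set_scope.
Local Open Scope ring_scope.

(** * Configurations and elementary events *)

(** Single moves are not steps of the process, so its own tail probability has no evident
    superharmonicity; the optimal value has it by construction. Little is lost, because a full step
    contains the single move that an optimal schedule makes next.

    The obstacle in comparing degrees is that [pstar] increases with the degree, while no order is
    available between stepping to the parent and opening a child: shifting probability from the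
    second to the first might lower the value. So the inward weight and the total weight of the
    unvisited children must both grow. For a just activated particle every child has weight (1 - 2p)
    / (d - (d + 1)p). With n unvisited children out of d, and n + 1 out of d + 1, the requirement
    becomes n(1 - p) <= d - (d + 1)p. It fails for n = d, and for n = d - 1 it reads p <= 1/2: one
    visited child is exactly what is needed. The activating particle supplies it: its last step led
    away from the root, so its next one goes to a child, which is visited afterwards whether or not
    it was before. *)

(* Letters are arbitrary, so that the trees of all degrees share their vertices. *)
Definition word := seq nat.

(* The vertex occupied one step earlier (None if just activated) and the current
   one. *)
Definition particle := (option word * word)%type.

(* The pool is a multiset given by its multiplicities, which makes equality of
   configurations extensional. *)
Record config := Config {
  visited : word -> bool;
  pool : particle -> nat;
  visits : nat }.

Definition add_particles (k : nat) (a : particle) (c : config) : config :=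
  Config (visited c) (fun b => (k * (b == a) + pool c b)%N) (visits c).

Definition add_visit (c : config) : config :=
  Config (visited c) (pool c) (visits c).+1.

Definition mark (x : word) (c : config) : config :=
  Config (fun z => (z == x) || visited c z) (pool c) (visits c).

Definition open_at (x : word) (k : nat) (c : config) : config :=
  mark x (add_particles 1 (Some (behead x), x) (add_particles k (None, x) c)).

(* Enter x is an attempt to move away from the root to x. *)
Inductive event := Appear of particle | RootVisit | Enter of word.

Section Expectation.
Context (R : realType) (nu : probability nat R).
Local Open Scope ereal_scope.

Definition nuE (f : nat -> \bar R) : \bar R := \int[nu]_k f k.

Lemma nuE_series f : (forall k, 0 <= f k) ->
  nuE f = \sum_(0 <= k <oo) nu [set k] * f k.
Proof.
move=> f0; rewrite /nuE.
have T : [set: nat] = \bigcup_k [set k].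
  by apply/seteqP; split => // k _; exists k.
rewrite T ge0_integral_bigcup//; last by move=> i j _ _ [k [-> ->]].
apply: eq_eseriesr => k _.
rewrite (eq_integral (cst (f k))); last by move=> x /[!inE] ->.
by rewrite integral_cst// muleC.
Qed.

(** Dormant particles are sampled when their vertex is opened, so configurations need not record
    them. A visited [x] leaves [c] unchanged: the entering particle, already taken out of the pool,
    is killed. *)
Definition eventE (o : event) (F : config -> \bar R) (c : config) : \bar R :=
  match o with
  | Appear a => F (add_particles 1 a c)
  | RootVisit => F (add_visit c)
  | Enter x => if visited c x then F c else nuE (fun k => F (open_at x k c))
  end.

Definition nonneg (F : config -> \bar R) := forall c, 0 <= F c.

Lemma eventE_ge0 o F : nonneg F -> nonneg (eventE o F).
Proof.
move=> F0 c; case: o => [a||x] //=; case: ifP => // _.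
exact: integral_ge0.
Qed.

Lemma nuE_le (f g : nat -> \bar R) :
  (forall k, 0 <= f k) -> (forall k, f k <= g k) -> nuE f <= nuE g.
Proof.
by move=> f0 fg; apply: ge0_le_integral => // k _; exact: f0.
Qed.

Lemma nuE_cst r : nuE (fun=> r) = r.
Proof.
rewrite /nuE integral_cst//.
by rewrite [X in _ * X](@probability_setT _ _ _ nu) mule1.
Qed.

Lemma nuE_interchange (f : nat -> nat -> \bar R) : (forall k l, 0 <= f k l) ->
  nuE (fun k => nuE (f k)) = nuE (fun l => nuE (f ^~ l)).
Proof.
move=> f0.
have E g : (forall k l, 0 <= g k l) -> nuE (fun k => nuE (g k)) =
    \sum_(0 <= k <oo) \sum_(0 <= l <oo) nu [set k] * (nu [set l] * g k l).
  move=> g0; rewrite nuE_series; last by move=> k; exact: integral_ge0.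
  apply: eq_eseriesr => k _; rewrite nuE_series//.
  have -> : nu [set k] = (fine (nu [set k]))%:E.
    by rewrite fineK//; exact: fin_num_measure.
  rewrite -nneseriesZl//.
  by move=> l _; rewrite mule_ge0.
rewrite (E _ f0) (E (fun l k => f k l)); last by move=> k l; exact: f0.
rewrite nneseries_interchange; last by move=> k l; rewrite !mule_ge0.
by apply: eq_eseriesr => k _; apply: eq_eseriesr => l _; rewrite muleCA.
Qed.

Lemma eventE_le o F G c : nonneg F -> (forall c', F c' <= G c') ->
  eventE o F c <= eventE o G c.
Proof.
move=> F0 FG; case: o => [a||x] //=; case: ifP => // _; exact: nuE_le.
Qed.

Lemma add_particlesC k a l b c :
  add_particles k a (add_particles l b c) = add_particles l b (add_particles k a c).
Proof. by congr Config; apply/funext => e /=; rewrite addnCA. Qed.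

Lemma open_atC x k y l c :
  open_at x k (open_at y l c) = open_at y l (open_at x k c).
Proof.
congr Config; apply/funext => e /=; first by rewrite orbCA.
by lia.
Qed.

Lemma open_at_add x k l a c :
  open_at x k (add_particles l a c) = add_particles l a (open_at x k c).
Proof. by congr Config; apply/funext => e /=; lia. Qed.

(** Only two entries can interact. At the same vertex the two sides are the same expression; at
    distinct vertices neither opening affects whether the other vertex is visited, and the two
    numbers of sleepers are exchanged by Tonelli. *)
Lemma eventEC o1 o2 F c : nonneg F ->
  eventE o1 (eventE o2 F) c = eventE o2 (eventE o1 F) c.
Proof.
have opens a x G c' : eventE (Enter x) (fun c1 => G (add_particles 1 a c1)) c' =
    eventE (Enter x) G (add_particles 1 a c').
  rewrite /eventE /=; case: (visited c' x); first by [].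
  by congr nuE; apply/funext => k; rewrite open_at_add.
move=> F0; case: o1 o2 => [a||x] [b||y].
- by rewrite /eventE add_particlesC.
- by [].
- exact: esym (opens a y F c).
- by [].
- by [].
- by [].
- exact: opens b x F c.
- by [].
have [->|xy] := eqVneq x y; first by [].
rewrite /eventE /=.
case vx: (visited c x); case vy: (visited c y).
- by [].
- by congr nuE; apply/funext => k /=; rewrite orbT.
- by congr nuE; apply/funext => k /=; rewrite orbT.
transitivity (nuE (fun k => nuE (fun l => F (open_at y l (open_at x k c))))).
  by congr nuE; apply/funext => k /=; rewrite eq_sym (negbTE xy).
transitivity (nuE (fun l => nuE (fun k => F (open_at x k (open_at y l c))))); last first.
  by congr nuE; apply/funext => k /=; rewrite (negbTE xy).
rewrite (@nuE_interchange (fun k l => F (open_at y l (open_at x k c)))); last first.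
  by move=> k l; exact: F0.
congr nuE; apply/funext => k; congr nuE; apply/funext => l; congr F.
exact: open_atC.
Qed.

Lemma eventE_sum o (I : Type) (s : seq I) (w : I -> R) (F : I -> config -> \bar R) c :
  (forall i, (0 <= w i)%R) -> (forall i, nonneg (F i)) ->
  eventE o (fun c' => \sum_(i <- s) (w i)%:E * F i c') c =
  \sum_(i <- s) (w i)%:E * eventE o (F i) c.
Proof.
move=> w0 F0; case: o => [a||x] //=; case: ifP => _; first by [].
rewrite /nuE ge0_integral_sum; first last.
- by move=> i k _; apply: mule_ge0; [rewrite lee_fin|exact: F0].
- by [].
- by [].
apply: eq_bigr => i _; rewrite ge0_integralZl; first by [].
- by [].
- by [].
- by move=> k _; exact: F0.
- by rewrite lee_fin.
Qed.

End Expectation.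

(** * The one-particle move *)

Definition children (D : nat) (v : word) : seq word :=
  [seq j :: v | j <- iota 0 D].

Lemma childrenP D v u :
  reflect (exists2 j, (j < D)%N & u = j :: v) (u \in children D v).
Proof.
by apply: (iffP mapP) => -[j]; rewrite ?mem_iota => jD ->; exists j; rewrite ?mem_iota.
Qed.

Section Kernel.
Context (R : realType) (nu : probability nat R) (p : R) (D : nat).

(* A previous vertex that is not a child of the current one means that the last
   step was away from the root. *)
Definition inward_weight (a : particle) : R :=
  match a.1 with
  | None => if a.2 == [::] then 0 else pstar D p
  | Some u => if u \in children D a.2 then phat p else 0
  end.

Definition outward_weight (a : particle) (j : nat) : R :=
  match a.1 with
  | None => if a.2 == [::] then D%:R^-1 else (1 - pstar D p) / D%:R
  | Some u =>
      if u \in children D a.2 then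
        if j :: a.2 == u then 0 else (1 - phat p) / (D%:R - 1)
      else D%:R^-1
  end.

(** Index 0 is the step to the parent and j + 1 the step to the child with letter j, so that all
    moves form a single sum. *)
Definition move_weight (a : particle) (i : nat) : R :=
  if i is j.+1 then outward_weight a j else inward_weight a.

(** At the root a particle is only counted. Elsewhere it reappears with [v] as previous vertex; [v]
    is a child of its new position, which encodes an inward last step. *)
Definition parent_event (v : word) : event :=
  if behead v == [::] then RootVisit else Appear (Some v, behead v).

Definition move_event (a : particle) (i : nat) : event :=
  if i is j.+1 then Enter (j :: a.2) else parent_event a.2.

(** Here [c] is the configuration without [a]; the events put back what survives. *)
Definition moveE (a : particle) (F : config -> \bar R) (c : config) : \bar R :=
  (\sum_(i < D.+1) (move_weight a i)%:E * eventE nu (move_event a i) F c)%E.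

(** All of [L] is outside the configuration from the start; particles activated on the way join the
    pool and are not moved. *)
Fixpoint sweepE (L : seq particle) (F : config -> \bar R) : config -> \bar R :=
  if L is a :: L' then moveE a (sweepE L' F) else F.

Hypothesis (p_gt0 : 0 < p) (p_lt_half : p < 2^-1) (D_ge2 : (2 <= D)%N).

Let Dr : (2%:R : R) <= D%:R. Proof. by rewrite ler_nat. Qed.

Lemma pstar_den_gt0 : 0 < D%:R - (D%:R + 1) * p.
Proof.
have h : (D%:R + 1) * p < (D%:R + 1) * 2^-1 by rewrite ltr_pM2l// addrC ltr_pwDl.
have := Dr; lra.
Qed.

Lemma pstar_ge0 : 0 <= pstar D p.
Proof.
rewrite /pstar divr_ge0 ?(ltW pstar_den_gt0)// mulr_ge0 ?(ltW p_gt0)//.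
have := Dr; lra.
Qed.

Lemma pstar_le1 : pstar D p <= 1.
Proof.
rewrite /pstar ler_pdivrMr ?pstar_den_gt0// mul1r.
have : p * D%:R <= 2^-1 * D%:R by rewrite ler_wpM2r ?ler0n// ltW.
lra.
Qed.

Lemma phat_ge0 : 0 <= phat p.
Proof. by rewrite /phat divr_ge0 ?(ltW p_gt0)//; have := p_lt_half; lra. Qed.

Lemma phat_le1 : phat p <= 1.
Proof. by rewrite /phat ler_pdivrMr; have := p_lt_half; lra. Qed.

Lemma move_weight_ge0 a i : 0 <= move_weight a i.
Proof.
case: a i => [[u|] v] [|j] /=; rewrite /inward_weight /outward_weight /=.
- by case: ifP => _ //; exact: phat_ge0.
- have D1 : 0 <= (D%:R - 1 : R) by have := Dr; lra.
  case: ifP => _; rewrite ?invr_ge0 ?ler0n//; case: ifP => _ //.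
  by rewrite divr_ge0// subr_ge0 phat_le1.
- by case: ifP => _ //; exact: pstar_ge0.
- by case: ifP => _; rewrite ?invr_ge0 ?divr_ge0 ?subr_ge0 ?pstar_le1 ?ler0n.
Qed.

Lemma sum_move_weight a : \sum_(i < D.+1) move_weight a i = 1.
Proof.
have D0 : (D%:R : R) != 0 by have := Dr; lra.
have D1 : (D%:R - 1 : R) != 0 by have := Dr; lra.
have cD (r : R) : \sum_(i < D) r = D%:R * r by rewrite sumr_const card_ord mulr_natl.
rewrite big_ord_recl /=; case: a => [[u|] v]; rewrite /inward_weight /outward_weight /=.
- case: childrenP => [[j jD ->]|_]; last by rewrite cD divff ?add0r.
  rewrite (bigD1 (Ordinal jD))//= eqxx add0r.
  under eq_bigr => i ij.
    rewrite eqseq_cons eqxx andbT.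
    have /negbTE -> : val i != j by apply: contraNneq ij => ij; apply/eqP/val_inj.
    over.
  have := cD ((1 - phat p) / (D%:R - 1)).
  rewrite (bigD1 (Ordinal jD))//= => /(canRL (addKr _)) ->.
  by field.
- case: ifP => _; first by rewrite cD divff ?add0r.
  by rewrite cD mulrCA divff// mulr1 addrC subrK.
Qed.

End Kernel.

(** * Optimal scheduling *)

Definition adds (L : seq particle) (c : config) : config :=
  foldr (add_particles 1) c L.

Lemma adds_add L a c : adds L (add_particles 1 a c) = add_particles 1 a (adds L c).
Proof. by elim: L => //= b L ->; rewrite add_particlesC. Qed.

Lemma pool_adds L c b : pool (adds L c) b = (count_mem b L + pool c b)%N.
Proof. by elim: L => //= a L ->; rewrite mul1n eq_sym addnA. Qed.

Lemma visited_adds L c : visited (adds L c) = visited c.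
Proof. by elim: L. Qed.

Lemma visits_adds L c : visits (adds L c) = visits c.
Proof. by elim: L. Qed.

Lemma config_eta c : c = Config (visited c) (pool c) (visits c).
Proof. by case: c. Qed.

Lemma add_particles_inj a : injective (add_particles 1 a).
Proof.
move=> c c' [] v P n; rewrite (config_eta c) (config_eta c') v n; congr Config.
apply/funext => b; have := congr1 (@^~ b) P; exact: addnI.
Qed.

(** Two decompositions of a multiset that single out different particles have a common
    refinement. *)
Lemma add_particles_diamond a b c c' : a != b ->
  add_particles 1 a c = add_particles 1 b c' ->
  exists c0, c = add_particles 1 b c0 /\ c' = add_particles 1 a c0.
Proof.
move=> ab [] v P n.
exists (Config (visited c) (fun e => pool c e - (e == b))%N (visits c)).
rewrite {1}(config_eta c) {1}(config_eta c').
have nab e : ~~ ((e == a) && (e == b)).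
  by apply/negP => /andP[/eqP -> /eqP eb]; rewrite eb eqxx in ab.
by split; congr Config => //; apply/funext => e /=;
  move: (congr1 (@^~ e) P) (nab e) => /=; case: (e == a); case: (e == b); lia.
Qed.

Section Value.
Context (R : realType) (nu : probability nat R) (p : R) (D : nat).
Hypothesis (p_gt0 : 0 < p) (p_lt_half : p < 2^-1) (D_ge2 : (2 <= D)%N).
Local Open Scope ereal_scope.

Local Notation w := (move_weight p D).
Local Notation eventE := (eventE nu).
Local Notation moveE := (moveE nu p D).
Local Notation sweepE := (sweepE nu p D).

Let w_ge0 a i : (0 <= w a i)%R. Proof. exact: move_weight_ge0. Qed.

Lemma moveE_ge0 a F : nonneg F -> nonneg (moveE a F).
Proof.
move=> F0 c; apply: sume_ge0 => i _; apply: mule_ge0; first by rewrite lee_fin.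
exact: eventE_ge0.
Qed.

Lemma sweepE_ge0 L F : nonneg F -> nonneg (sweepE L F).
Proof. by move=> F0; elim: L => //= a L IH; exact: moveE_ge0. Qed.

Lemma moveE_le a F G c : nonneg F -> (forall c', F c' <= G c') ->
  moveE a F c <= moveE a G c.
Proof.
move=> F0 FG; apply: lee_sum => i _; apply: lee_wpmul2l; first by rewrite lee_fin.
exact: eventE_le.
Qed.

Lemma sweepE_le L F G c : nonneg F -> (forall c', F c' <= G c') ->
  sweepE L F c <= sweepE L G c.
Proof.
move=> F0 FG; elim: L c => //= a L IH c.
by apply: moveE_le => //; exact: sweepE_ge0.
Qed.

Lemma eventE_moveE o a F c : nonneg F -> eventE o (moveE a F) c = moveE a (eventE o F) c.
Proof.
move=> F0; rewrite [LHS](@eventE_sum _ _ _ _ _ _ (fun i : 'I_D.+1 => eventE (move_event a i) F)).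
- by apply: eq_bigr => i _; rewrite eventEC.
- by move=> i; exact: w_ge0.
- by move=> i; exact: eventE_ge0.
Qed.

Lemma eventE_sweepE o L F c : nonneg F -> eventE o (sweepE L F) c = sweepE L (eventE o F) c.
Proof.
move=> F0; elim: L c => //= a L IH c.
rewrite eventE_moveE; last exact: sweepE_ge0.
by congr moveE; apply/funext.
Qed.

Lemma moveEC a b F c : nonneg F -> moveE a (moveE b F) c = moveE b (moveE a F) c.
Proof.
move=> F0; rewrite {1}/moveE.
under eq_bigr => i _ do rewrite eventE_moveE//.
rewrite [RHS](_ : _ = \sum_(j < D.+1) \sum_(i < D.+1)
   (w a i)%:E * ((w b j)%:E * eventE (move_event b j) (eventE (move_event a i) F) c)).
  rewrite exchange_big; apply: eq_bigr => i _.
  rewrite ge0_sume_distrr//.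
  move=> j _; apply: mule_ge0; first by rewrite lee_fin.
  by do 2 apply: eventE_ge0.
apply: eq_bigr => j _.
rewrite (@eventE_sum _ _ _ _ _ _ (fun i : 'I_D.+1 => eventE (move_event a i) F)); first last.
- by move=> i; exact: eventE_ge0.
- by move=> i; exact: w_ge0.
rewrite ge0_sume_distrr; last first.
  move=> i _; apply: mule_ge0; first by rewrite lee_fin.
  by do 2 apply: eventE_ge0.
by apply: eq_bigr => i _; rewrite muleCA.
Qed.

Lemma sweepE_moveE L a F c : nonneg F ->
  sweepE L (moveE a F) c = moveE a (sweepE L F) c.
Proof.
move=> F0; elim: L c => //= b L IH c.
rewrite -moveEC; last exact: sweepE_ge0.
by congr moveE; apply/funext.
Qed.

(** Adding a particle is itself an event, [Appear], and so commutes with moves. *)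
Lemma moveE_adds a L F c : nonneg F ->
  moveE a F (adds L c) = moveE a (fun c' => F (adds L c')) c.
Proof.
elim: L F => // b L IH F F0 /=.
rewrite -(IH (fun c' => F (add_particles 1 b c'))); last by move=> c'; exact: F0.
exact: (eventE_moveE (Appear b) a (adds L c) F0).
Qed.

Lemma le_moveE a F c r : 0 <= r -> (forall i, r <= eventE (move_event a i) F c) ->
  r <= moveE a F c.
Proof.
move=> r0 rF; have -> : r = \sum_(i < D.+1) (w a i)%:E * r.
  rewrite -ge0_sume_distrl; last by move=> i _; rewrite lee_fin.
  by rewrite sumEFin sum_move_weight// mul1e.
by apply: lee_sum => i _; apply: lee_wpmul2l => //; rewrite lee_fin.
Qed.

Lemma eventE_le1 o F c : nonneg F -> (forall c', F c' <= 1) -> eventE o F c <= 1.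
Proof.
move=> F0 F1; case: o => [a||x] //=; case: ifP => // _.
by rewrite -[leRHS](nuE_cst nu); exact: nuE_le.
Qed.

Lemma moveE_le1 a F c : nonneg F -> (forall c', F c' <= 1) -> moveE a F c <= 1.
Proof.
move=> F0 F1; have <- : \sum_(i < D.+1) (w a i)%:E = 1.
  by rewrite sumEFin sum_move_weight.
apply: lee_sum => i _; rewrite -[leRHS]mule1; apply: lee_wpmul2l.
  by rewrite lee_fin.
exact: eventE_le1.
Qed.

Variable m : nat.

(** The first alternative allows idling, which makes the value monotone in [n]. The schedule is
    adaptive: the next choice may depend on the configuration reached. *)
Fixpoint bestE (n : nat) (c : config) : \bar R :=
  match n with
  | 0%N => if (m <= visits c)%N then 1 else 0
  | n'.+1 => ereal_sup [set x | x = bestE n' c \/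
      exists a c', c = add_particles 1 a c' /\ x = moveE a (bestE n') c']
  end.

Lemma bestE_ge0 n : nonneg (bestE n).
Proof.
elim: n => [|n IH] c /=; first by case: ifP.
by apply: le_trans (IH c) _; apply: ereal_sup_ubound; left.
Qed.

Lemma bestE_le1 n c : bestE n c <= 1.
Proof.
elim: n c => [|n IH] c /=; first by case: ifP.
apply: ub_ereal_sup => x [->//|[a [c' [_ ->]]]].
by apply: moveE_le1 => //; exact: bestE_ge0.
Qed.

Lemma bestE_leS n c : bestE n c <= bestE n.+1 c.
Proof. by apply: ereal_sup_ubound; left. Qed.

Lemma moveE_bestE n a c : moveE a (bestE n) c <= bestE n.+1 (add_particles 1 a c).
Proof. by apply: ereal_sup_ubound; right; exists a, c. Qed.

Hint Resolve bestE_ge0 : core.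

(** The first move of a good schedule commutes with the event, so the schedule can still be followed
    after it; with no move left, an event can only raise the number of visits. *)
Lemma bestE_event n o c : bestE n c <= eventE o (bestE n) c.
Proof.
elim: n c => [|n IH] c.
  case: o => [a||x] //=.
    have [mv|_] := leqP m (visits c); last by case: ifP.
    by rewrite (leqW mv).
  by case: (visited c x) => //; rewrite nuE_cst.
rewrite [leLHS]/=; apply: ub_ereal_sup => x [->|[b [c' [-> ->]]]].
  by apply: le_trans (IH c) _; apply: eventE_le => // c'; exact: bestE_leS.
apply: (@le_trans _ _ (moveE b (eventE o (bestE n)) c')); first exact: moveE_le.
rewrite -eventE_moveE//.
rewrite -[leRHS]/(eventE (Appear b) (eventE o (bestE n.+1)) c') eventEC//.
by apply: eventE_le; [exact: moveE_ge0|move=> c''; exact: moveE_bestE].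
Qed.

(** Moving [a] at once and free of charge does no harm. If the schedule starts with another
    particle, the two moves commute; if it starts with [a], the free move replaces that one and a
    move is saved. *)
Lemma bestE_moveE n a c : bestE n (add_particles 1 a c) <= moveE a (bestE n) c.
Proof.
elim: n c => [|n IH] c.
  by apply: le_moveE => [|i]; [exact: bestE_ge0|exact: (bestE_event 0)].
rewrite [leLHS]/=; apply: ub_ereal_sup => x [->|[b [c' [E ->]]]].
  by apply: le_trans (IH c) _; apply: moveE_le => // c'; exact: bestE_leS.
have [ab|ab] := eqVneq a b.
  rewrite -ab in E *; rewrite (add_particles_inj E).
  by apply: moveE_le => // c''; exact: bestE_leS.
have [c0 [-> ->]] := add_particles_diamond ab E.
apply: (@le_trans _ _ (moveE b (moveE a (bestE n)) c0)).
  rewrite (moveE_adds b [:: a])//.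
  by apply: moveE_le => // c''; exact: bestE_ge0.
rewrite moveEC// (moveE_adds a [:: b])//.
by apply: moveE_le => [|c'']; [exact: moveE_ge0|exact: moveE_bestE].
Qed.

Lemma bestE_sweepE n L c : bestE n (adds L c) <= sweepE L (bestE n) c.
Proof.
elim: L c => //= a L IH c; apply: le_trans (bestE_moveE _ _ _) _.
rewrite moveE_adds//; apply: moveE_le => // c'; exact: bestE_ge0.
Qed.

(** The paid move of [b] is one of the moves of the sweep, and the other moves of the sweep are free
    by [bestE_moveE]. *)
Lemma moveE_sweepE n L b c c0 : b \in L -> adds L c = add_particles 1 b c0 ->
  moveE b (bestE n) c0 <= sweepE L (bestE n) c.
Proof.
elim: L c => // a L IH c; rewrite inE; have [-> _ /add_particles_inj <-|ba /= bL] := eqVneq b a.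
  rewrite moveE_adds//; apply: moveE_le => [c'|c']; first exact: bestE_ge0.
  exact: bestE_sweepE.
rewrite -adds_add => /(IH _ bL)/le_trans; apply.
rewrite -[leLHS]/(eventE (Appear a) (sweepE L (bestE n)) c) eventE_sweepE//.
rewrite -sweepE_moveE//; apply: sweepE_le => [c'|c']; first exact: bestE_ge0.
exact: bestE_moveE.
Qed.

(** As the pool of [c] is empty, the particle that a schedule moves first belongs to [L]. Iterated,
    this shows that n single moves never beat n full steps. *)
Lemma bestE_sync n L c : (forall a, pool c a = 0%N) ->
  bestE n.+1 (adds L c) <= sweepE L (bestE n) c.
Proof.
move=> c0; rewrite [leLHS]/=; apply: ub_ereal_sup => x [->|[b [c' [E ->]]]].
  exact: bestE_sweepE.
apply: (moveE_sweepE n _ E); have := congr1 (fun c1 => pool c1 b) E.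
rewrite pool_adds c0 addn0 /= eqxx mul1n => h.
by rewrite -has_pred1 has_count h.
Qed.

Definition supE (c : config) : \bar R := ereal_sup (range (bestE ^~ c)).

Lemma bestE_supE n c : bestE n c <= supE c.
Proof. by apply: ereal_sup_ubound; exists n. Qed.

Lemma supE_ge0 : nonneg supE.
Proof. by move=> c; exact: le_trans (bestE_ge0 0 c) (bestE_supE _ _). Qed.

Lemma supE_le1 c : supE c <= 1.
Proof. by apply: ub_ereal_sup => _ [n _ <-]; exact: bestE_le1. Qed.

(** This is why being killed is never better than any other event: it leaves [c] as it is. *)
Lemma supE_event o c : supE c <= eventE o supE c.
Proof.
apply: ub_ereal_sup => _ [n _ <-]; apply: le_trans (bestE_event n o c) _.
by apply: eventE_le => // c'; exact: bestE_supE.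
Qed.

Lemma bestE_mono c : nondecreasing_seq (bestE ^~ c).
Proof. by apply/nondecreasing_seqP => n; exact: bestE_leS. Qed.

Lemma bestE_cvg c : bestE n c @[n --> \oo] --> supE c.
Proof. exact: ereal_nondecreasing_cvgn (@bestE_mono c). Qed.

Lemma eventE_bestE_cvg o c : eventE o (bestE n) c @[n --> \oo] --> eventE o supE c.
Proof.
case: o => [a||x] /=; [exact: bestE_cvg|exact: bestE_cvg|].
case: ifP => _; first exact: bestE_cvg.
rewrite /nuE.
have -> : (fun k => supE (open_at x k c)) =
    (fun k => limn (fun n => bestE n (open_at x k c))).
  by apply/funext => k; apply/esym/cvg_lim => //; exact: bestE_cvg.
apply: cvg_monotone_convergence => //.
- by move=> n k _; exact: bestE_ge0.
- by move=> k _; exact: bestE_mono.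
Qed.

(** Superharmonicity: a move costs one unit of the horizon, which the limit forgets. *)
Lemma supE_moveE a c : moveE a supE c <= supE (add_particles 1 a c).
Proof.
have h : moveE a (bestE n) c @[n --> \oo] --> moveE a supE c.
  apply: cvg_nnesum => [i _|i _].
    by apply: nearW => n; apply: mule_ge0; [rewrite lee_fin|exact: eventE_ge0].
  by apply: cvgeZl => //; exact: eventE_bestE_cvg.
rewrite -(cvg_lim _ h)//; apply: lime_le; first by apply/cvg_ex; eexists; exact: h.
by apply: nearW => n; exact: le_trans (moveE_bestE n a c) (bestE_supE _ _).
Qed.

End Value.

(** * Exchanging two unvisited children *)

Section Swap.
Variables (D : nat) (v0 : word) (i0 j0 : nat).
Hypotheses (i0D : (i0 < D)%N) (j0D : (j0 < D)%N).

Definition swap_letter (v : word) (k : nat) : nat :=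
  if v == v0 then if k == i0 then j0 else if k == j0 then i0 else k else k.

(** The tree automorphism that exchanges the subtrees at [i0 :: v0] and [j0 :: v0]: only the letter
    standing directly in front of the suffix [v0] changes. *)
Fixpoint swap (w : word) : word :=
  if w is k :: v then swap_letter v k :: swap v else [::].

Definition swap_particle (a : particle) : particle := (omap swap a.1, swap a.2).

Definition swap_config (c : config) : config :=
  Config (visited c \o swap) (pool c \o swap_particle) (visits c).

Definition swap_event (o : event) : event :=
  match o with
  | Appear a => Appear (swap_particle a)
  | RootVisit => RootVisit
  | Enter x => Enter (swap x)
  end.

Lemma swap_letterK v : involutive (swap_letter v).
Proof.
move=> k; rewrite /swap_letter; case: (v == v0) => //.
by case: (eqVneq k i0) => [->|ki]; [|case: (eqVneq k j0) => [->|kj]];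
  rewrite /= ?eqxx ?(negbTE ki) ?(negbTE kj)//; case: eqP.
Qed.

Lemma swap_letter_lt v k : (k < D)%N -> (swap_letter v k < D)%N.
Proof.
by rewrite /swap_letter; case: (v == v0) => //; case: (k == i0) => //; case: (k == j0).
Qed.

Lemma swap_short w : (size w <= size v0)%N -> swap w = w.
Proof.
elim: w => //= k w IH sw; rewrite IH 1?ltnW// /swap_letter.
by case: eqP => // wv; rewrite wv ltnn in sw.
Qed.

Lemma swapK : involutive swap.
Proof.
elim=> //= k w IH; rewrite IH; congr cons.
have -> : swap_letter (swap w) =1 swap_letter w; last exact: swap_letterK.
move=> l; rewrite /swap_letter; have -> // : (swap w == v0) = (w == v0).
apply/eqP/eqP => [h|->]; last by rewrite swap_short.
by rewrite -[LHS]IH h swap_short.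
Qed.

Let swapE u w : (swap u == w) = (u == swap w).
Proof. exact: can2_eq swapK swapK u w. Qed.

Lemma behead_swap w : behead (swap w) = swap (behead w).
Proof. by case: w. Qed.

Lemma swap_particleK : involutive swap_particle.
Proof. by move=> [[u|] v]; rewrite /swap_particle /= !swapK. Qed.

Let swap_particleE a b : (swap_particle a == b) = (a == swap_particle b).
Proof. exact: can2_eq swap_particleK swap_particleK a b. Qed.

Lemma swap_configK : involutive swap_config.
Proof.
by move=> [V P n]; congr Config; apply/funext => z /=;
  rewrite ?swapK ?swap_particleK.
Qed.

Lemma swap_add k a c :
  swap_config (add_particles k a c) =
  add_particles k (swap_particle a) (swap_config c).
Proof. by congr Config; apply/funext => b /=; rewrite swap_particleE. Qed.

Lemma swap_open x k c :
  swap_config (open_at x k c) = open_at (swap x) k (swap_config c).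
Proof.
congr Config; apply/funext => b /=; first by rewrite swapE.
by rewrite !swap_particleE /swap_particle /= behead_swap.
Qed.

Context (R : realType) (nu : probability nat R) (p : R).

Lemma eventE_swap o F c :
  eventE nu (swap_event o) F (swap_config c) = eventE nu o (F \o swap_config) c.
Proof.
case: o => [a||x] /=; rewrite ?swap_add ?swapK//.
by congr (if _ then _ else nuE nu _); apply/funext => k /=; rewrite swap_open.
Qed.

Lemma mem_children_swap u v : (swap u \in children D (swap v)) = (u \in children D v).
Proof.
wlog suff: u v / u \in children D v -> swap u \in children D (swap v).
  by move=> h; apply/idP/idP => [/h|/h//]; rewrite !swapK.
by case/childrenP => j jD ->; apply/childrenP; exists (swap_letter v j);
  rewrite ?swap_letter_lt.
Qed.

Lemma inward_weight_swap a : inward_weight p D (swap_particle a) = inward_weight p D a.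
Proof.
case: a => [[u|] v]; rewrite /inward_weight /= ?mem_children_swap//.
by case: v.
Qed.

Lemma outward_weight_swap a k :
  outward_weight p D (swap_particle a) (swap_letter a.2 k) = outward_weight p D a k.
Proof.
case: a => [[u|] v]; rewrite /outward_weight /= ?mem_children_swap//; last by case: v.
by rewrite -[_ :: _]/(swap (k :: v)) swapE swapK.
Qed.

Lemma moveE_swap a F c :
  moveE nu p D (swap_particle a) F (swap_config c) = moveE nu p D a (F \o swap_config) c.
Proof.
rewrite /moveE !big_ord_recl /=; congr (_ + _)%E.
  rewrite inward_weight_swap -eventE_swap; congr (_ * eventE _ _ _ _)%E.
  by case: a => u [|k [|l v]].
pose f (k : 'I_D) := Ordinal (swap_letter_lt a.2 (ltn_ord k)).
have fK : involutive f by move=> k; apply/val_inj; exact: swap_letterK.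
rewrite (reindex_inj (inv_inj fK)) /=; apply: eq_bigr => k _.
rewrite outward_weight_swap; congr (_ * _)%E.
exact: (eventE_swap (Enter (val k :: a.2))).
Qed.

(** As [swap_config] is an involution, one inequality for all configurations gives the equality. *)
Lemma bestE_swap m n c : bestE nu p D m n (swap_config c) = bestE nu p D m n c.
Proof.
have h c' : (bestE nu p D m n c' <= bestE nu p D m n (swap_config c'))%E.
  elim: n c' => [//|n IH] c'.
  rewrite [leLHS]/=; apply: ub_ereal_sup => x [->|[a [c1 [-> ->]]]].
    by apply: le_trans (IH _) _; exact: bestE_leS.
  have E : bestE nu p D m n \o swap_config = bestE nu p D m n.
    apply/funext => c2 /=; apply/eqP; rewrite eq_le IH andbT.
    by rewrite -[c2 in leRHS]swap_configK IH.
  rewrite -{1}E -moveE_swap swap_add; exact: moveE_bestE.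
by apply/eqP; rewrite eq_le h andbT -[c in leRHS]swap_configK h.
Qed.

Lemma supE_swap m c : supE nu p D m (swap_config c) = supE nu p D m c.
Proof.
rewrite /supE; suff -> : (bestE nu p D m)^~ (swap_config c) = (bestE nu p D m)^~ c by [].
by apply/funext => n; exact: bestE_swap.
Qed.

End Swap.

(** * Configurations that the exchange leaves fixed *)

Section Supported.
Variable D : nat.

Definition present (c : config) (a : particle) : Prop :=
  visited c a.2 /\ (forall u, a.1 = Some u -> visited c u).

(** The visited vertices form a subtree of the D-ary tree that carries all particles; in the
    (D+1)-ary tree the letter [D] therefore always names an unvisited child. *)
Definition supported (c : config) : Prop :=
  (forall j v, visited c (j :: v) -> (j < D)%N /\ visited c v) /\
  (forall a, (0 < pool c a)%N -> present c a).

(** Nothing is visited at or below an unvisited child, so exchanging two such subtrees moves neither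
    a visited vertex nor a particle. *)
Lemma swap_supported v i j c : supported c ->
  ~~ visited c (i :: v) -> ~~ visited c (j :: v) ->
  swap_config v i j c = c.
Proof.
move=> [tree pres] ni nj.
have fixV z : visited c z -> swap v i j z = z.
  elim: z => //= k z IH kz; have [_ vz] := tree _ _ kz; rewrite (IH vz); congr cons.
  rewrite /swap_letter; case: eqP => // zv; rewrite zv in kz.
  by case: eqP => [ki|_]; [rewrite -ki kz in ni|case: eqP => // kj; rewrite -kj kz in nj].
have fixP a : (0 < pool c a)%N -> swap_particle v i j a = a.
  case: a => [[u|] w] /pres[/= vw vu]; rewrite /swap_particle /= (fixV _ vw)//.
  by rewrite (fixV _ (vu _ erefl)).
clear tree pres ni nj; case: c fixV fixP => V P n /= fixV fixP; congr Config => /=.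
  apply/funext => z /=; apply/idP/idP => [h|h]; last by rewrite fixV.
  by have := fixV _ h; rewrite swapK => ->.
apply/funext => a /=; case: (posnP (P a)) => [Pa|/fixP -> //].
case: (posnP (P (swap_particle v i j a))) => [->//|Psa].
by have := fixP _ Psa; rewrite swap_particleK => <-.
Qed.

End Supported.

(** * Degree d against degree d + 1 *)

Section Compare.
Context (R : realType) (nu : probability nat R) (p : R) (D m : nat).
Hypothesis (p_gt0 : 0 < p) (p_lt_half : p < 2^-1) (D_ge2 : (2 <= D)%N).

Let D1_ge2 : (2 <= D.+1)%N. Proof. exact: leqW. Qed.
Let Dr : (2%:R : R) <= D%:R. Proof. by rewrite ler_nat. Qed.

Local Notation G := (supE nu p D.+1 m).
Local Notation eventG o c := (eventE nu o G c).

(** The exchange fixes [c] and maps one opening to the other, and the value is invariant under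
    it. *)
Lemma eventE_sym c v i j : supported D c -> (i < D.+1)%N -> (j < D.+1)%N ->
  ~~ visited c (i :: v) -> ~~ visited c (j :: v) ->
  eventG (Enter (i :: v)) c = eventG (Enter (j :: v)) c.
Proof.
move=> sc iD jD ni nj; rewrite /= (negbTE ni) (negbTE nj).
congr nuE; apply/funext => k; rewrite -(supE_swap v iD jD) swap_open.
rewrite (swap_supported sc ni nj); congr (G (open_at _ k c)).
by rewrite /= swap_short// /swap_letter !eqxx.
Qed.

Lemma pstar_mono : pstar D p <= pstar D.+1 p.
Proof.
rewrite /pstar ler_pdivrMr ?pstar_den_gt0// mulrAC ler_pdivlMr ?pstar_den_gt0//.
rewrite -subr_ge0 -natr1.
have -> : p * (D%:R + 1 - 1) * (D%:R - (D%:R + 1) * p) -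
  p * (D%:R - 1) * (D%:R + 1 - (D%:R + 1 + 1) * p) = p * (1 - 2 * p) by ring.
by apply: mulr_ge0; have := p_lt_half; have := p_gt0; lra.
Qed.

(** The numerator of 1 - [pstar] is D'(1 - 2p), so the division by D' leaves a numerator free of the
    degree. *)
Lemma fresh_rate D' : (2 <= D')%N ->
  (1 - pstar D' p) / D'%:R = (1 - 2 * p) / (D'%:R - (D'%:R + 1) * p).
Proof.
move=> D2; have D0 : (D'%:R : R) != 0 by rewrite pnatr_eq0; case: D' D2.
have := pstar_den_gt0 p_lt_half D2; rewrite /pstar => h.
by field; rewrite D0 gt_eqF.
Qed.

Section Move.
Variables (c : config) (a : particle).
Hypothesis sc : supported D c.
Hypothesis pa : present c a.

Let fresh (j : nat) : R := (~~ visited c (j :: a.2))%:R.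
Let newborn D' : R := \sum_(j < D') fresh j.
Let spread D' : R := \sum_(j < D') outward_weight p D' a j * fresh j.
(** The values after a killing, a step to the parent and the opening of a child. The child with
    letter [D] is unvisited and stands for all unvisited children. *)
Let K := fine (G c).
Let U := fine (eventG (parent_event a.2) c).
Let N := fine (eventG (Enter (D :: a.2)) c).

Let not_D : ~~ visited c (D :: a.2).
Proof. by apply/negP => /(sc.1 _ _)[]; rewrite ltnn. Qed.

Let fin_event o : eventG o c \is a fin_num.
Proof.
rewrite ge0_fin_numE; last by apply: eventE_ge0; exact: supE_ge0.
apply: le_lt_trans (ltry 1%R); apply: eventE_le1; first exact: supE_ge0.
by move=> c'; exact: supE_le1.
Qed.

Let KE : G c = K%:E. Proof. by rewrite fineK//; have := fin_event (Enter a.2); rewrite /= pa.1. Qed.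

Let enterE j : (j < D.+1)%N ->
  eventG (Enter (j :: a.2)) c = (K + fresh j * (N - K))%:E.
Proof.
move=> jD; rewrite /fresh; case vj: (visited c (j :: a.2)).
  by rewrite /= vj KE mul0r addr0.
rewrite mul1r addrCA subrr addr0 fineK; last exact: fin_event.
by apply: eventE_sym => //; rewrite vj.
Qed.

(** Measured from the value [K] of a killing, the degree enters only through two probabilities: that
    of stepping to the parent, and that of entering some unvisited child, which is [spread]. *)
Lemma moveE_mean D' : (2 <= D')%N -> (D' <= D.+1)%N ->
  moveE nu p D' a G c =
  (K + inward_weight p D' a * (U - K) + spread D' * (N - K))%:E.
Proof.
move=> D2 DD; rewrite /moveE big_ord_recl /=.
have -> : eventG (parent_event a.2) c = U%:E by rewrite fineK.
rewrite (eq_bigr (fun j : 'I_D' =>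
   (outward_weight p D' a j * (K + fresh j * (N - K)))%:E)); last first.
  move=> j _; rewrite add0n EFinM; congr (_ * _)%E.
  exact: (enterE (leq_trans (ltn_ord j) DD)).
rewrite sumEFin -EFinM -EFinD; congr (_%:E).
have := sum_move_weight p D2 a; rewrite big_ord_recl /=.
set S := \sum_(i < D') _ => sum1.
have -> : \sum_(j < D') outward_weight p D' a j * (K + fresh j * (N - K)) =
    S * K + spread D' * (N - K).
  rewrite /S /spread !mulr_suml -big_split /=; apply: eq_bigr => j _.
  by rewrite mulrDr mulrA.
rewrite (_ : S = 1 - inward_weight p D' a); first by ring.
by rewrite -sum1 addrC addKr.
Qed.

Let leKU : K <= U.
Proof. by rewrite -lee_fin -KE fineK//; exact: supE_event. Qed.

Let leKN : K <= N.
Proof. by rewrite -lee_fin -KE fineK//; exact: supE_event. Qed.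

Let newbornS : newborn D.+1 = newborn D + 1.
Proof. by rewrite /newborn big_ord_recr /= /fresh not_D. Qed.

Let fresh_le1 j : fresh j <= 1. Proof. by rewrite /fresh; case: visited. Qed.

Let newborn_ge0 : 0 <= newborn D.
Proof. by apply: sumr_ge0 => j _; rewrite ler0n. Qed.

Let newborn_le : newborn D <= D%:R.
Proof.
rewrite -[D in leRHS]card_ord -sumr_const; apply: ler_sum => j _; exact: fresh_le1.
Qed.

Let newborn_lt j : visited c (j :: a.2) -> newborn D <= D%:R - 1.
Proof.
move=> vj; have [jD _] := sc.1 _ _ vj.
rewrite /newborn (bigD1 (Ordinal jD))//= {1}/fresh vj add0r.
have <- : \sum_(i < D | i != Ordinal jD) (1 : R) = D%:R - 1.
  have := sumr_const 'I_D (1 : R); rewrite card_ord (bigD1 (Ordinal jD))//= => <-.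
  by rewrite addrAC subrr add0r.
by apply: ler_sum => i _; exact: fresh_le1.
Qed.

Let spread_cst D' q : (forall j : 'I_D', outward_weight p D' a j * fresh j = q * fresh j) ->
  spread D' = q * newborn D'.
Proof. by move=> h; rewrite /newborn mulr_sumr; exact: eq_bigr. Qed.

(** From n unvisited children out of D to n + 1 out of D + 1 the unvisited fraction grows, because n
    <= D. *)
Let uniform_le : D%:R^-1 * newborn D <= D.+1%:R^-1 * newborn D.+1.
Proof.
rewrite newbornS mulrC ler_pdivrMr; last by have := Dr; lra.
rewrite -mulrA mulrC ler_pdivlMr ?ltr0n// -natr1.
have := newborn_le; have := newborn_ge0; nra.
Qed.

Hypothesis visited_child : a.1 = None -> a.2 != [::] ->
  exists j, visited c (j :: a.2).

(** Since K <= U and K <= N, it is enough that the inward weight and [spread] both grow with the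
    degree. *)
Lemma moveE_compare : (moveE nu p D a G c <= moveE nu p D.+1 a G c)%E.
Proof.
rewrite !moveE_mean// ?leqW// lee_fin.
suff [inw spr] : inward_weight p D a <= inward_weight p D.+1 a /\
    spread D <= spread D.+1.
  apply: lerD; last by apply: ler_wpM2r => //; rewrite subr_ge0.
  by rewrite lerD2l; apply: ler_wpM2r => //; rewrite subr_ge0.
case Ea: a.1 => [u|].
- have vu : visited c u by exact: pa.2.
  have uD : (u \in children D.+1 a.2) = (u \in children D a.2).
    apply/childrenP/childrenP => -[j jD uE]; exists j => //; last exact: leqW.
    by rewrite uE in vu; have [] := sc.1 _ _ vu.
  rewrite /inward_weight Ea uD; split; first by [].
  case uc: (u \in children D a.2); last first.
    rewrite (@spread_cst D D%:R^-1) ?(@spread_cst D.+1 D.+1%:R^-1); first exact: uniform_le.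
    - by move=> j; rewrite /outward_weight Ea uD uc.
    - by move=> j; rewrite /outward_weight Ea uc.
  (* The child [u] just left has weight 0, but it is visited, so [fresh] vanishes there and the
     common weight may be used for it too. *)
  have out D' (j : 'I_D') : (u \in children D' a.2) ->
      outward_weight p D' a j * fresh j = (1 - phat p) / (D'%:R - 1) * fresh j.
    move=> uc'; rewrite /outward_weight Ea uc' /fresh.
    by case: eqP => [->|//]; rewrite vu !mulr0.
  rewrite (@spread_cst D ((1 - phat p) / (D%:R - 1)))
    ?(@spread_cst D.+1 ((1 - phat p) / (D.+1%:R - 1))); last 2 first.
  + by move=> j; apply: out; rewrite uD.
  + by move=> j; exact: out.
  have nD : newborn D <= D%:R - 1.
    by case/childrenP: uc => j _ uE; apply: (newborn_lt (j := j)); rewrite -uE.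
  rewrite -!mulrA; apply: ler_wpM2l; first by rewrite subr_ge0 phat_le1.
  rewrite newbornS -natr1 addrK mulrC ler_pdivrMr; last by have := Dr; lra.
  rewrite -mulrA mulrC ler_pdivlMr; last by have := Dr; lra.
  by nra.
- case: (eqVneq a.2 [::]) => [a0|a0].
    rewrite /inward_weight Ea a0 eqxx; split; first by [].
    rewrite (@spread_cst D D%:R^-1) ?(@spread_cst D.+1 D.+1%:R^-1); first exact: uniform_le.
    - by move=> j; rewrite /outward_weight Ea a0 eqxx.
    - by move=> j; rewrite /outward_weight Ea a0 eqxx.
  have [j vj] := visited_child Ea a0.
  have nD := newborn_lt vj.
  rewrite /inward_weight Ea (negbTE a0); split; first exact: pstar_mono.
  rewrite (@spread_cst D ((1 - pstar D p) / D%:R))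
    ?(@spread_cst D.+1 ((1 - pstar D.+1 p) / D.+1%:R)); last 2 first.
  + by move=> i; rewrite /outward_weight Ea (negbTE a0).
  + by move=> i; rewrite /outward_weight Ea (negbTE a0).
  rewrite !fresh_rate// -!mulrA.
  apply: ler_wpM2l; first by have := p_lt_half; lra.
  rewrite newbornS mulrC ler_pdivrMr ?pstar_den_gt0//.
  rewrite -mulrA mulrC ler_pdivlMr ?pstar_den_gt0// -natr1.
  (* The goal amounts to newborn D * (1 - p) <= D - (D + 1)p, whose slack is this product plus 1 -
     2p. *)
  have : 0 <= (D%:R - 1 - newborn D) * (1 - p).
    by apply: mulr_ge0; [rewrite subr_ge0|have := p_lt_half; lra].
  have := p_lt_half; have := newborn_ge0; nra.
Qed.

End Move.

End Compare.

(* A particle just activated at v will find a visited child of v when its turn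
   comes, because the particle that activated it moves first. *)
Definition fresh_ready (L : seq particle) (c : config) : Prop :=
  forall L1 v L2, L = L1 ++ (None, v) :: L2 ->
    [\/ v = [::], exists j, visited c (j :: v) | (Some (behead v), v) \in L1].

(** * A full step in degree D against the optimal value in degree D + 1 *)

Section Sweep.
Variable D : nat.

Definition ready (L : seq particle) (c : config) : Prop :=
  supported D (adds L c) /\ fresh_ready L c.

(** Once [a] has moved it is no longer a pending activator, so if it was one it must have left a
    visited child behind. *)
Lemma fresh_ready_behead a L c c' :
  (forall z, visited c z -> visited c' z) ->
  (forall v, v != [::] -> a = (Some (behead v), v) -> exists j, visited c' (j :: v)) ->
  fresh_ready (a :: L) c -> fresh_ready L c'.
Proof.
move=> cc' ac' fr L1 v L2 LE.
have [->|[j vj]|] := fr (a :: L1) v L2 (congr1 (cons a) LE).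
- exact: Or31.
- by apply: Or32; exists j; exact: cc'.
- rewrite inE => /orP[/eqP aE|]; last exact: Or33.
  by have [->|v0] := eqVneq v [::]; [exact: Or31|apply: Or32; exact: (ac' v v0 (esym aE))].
Qed.

Lemma ready_present a L c : ready (a :: L) c -> present c a.
Proof.
move=> [[_ pr] _]; have := pr a; rewrite /= eqxx mul1n /present /= visited_adds.
by apply.
Qed.

Lemma ready_appear a b L c : ready (a :: L) c -> present c b ->
  (forall v, v != [::] -> a = (Some (behead v), v) -> exists j, visited c (j :: v)) ->
  ready L (add_particles 1 b c).
Proof.
move=> [[tree pr] fr] pb ac; split; last exact: fresh_ready_behead fr.
split=> [j v|e]; first by have := tree j v; rewrite /= !visited_adds.
rewrite /present /= visited_adds pool_adds /= mul1n.
have [-> _|eb] := eqVneq e b; first exact: pb.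
have := pr e; rewrite /present /= visited_adds pool_adds mul1n add0n => h le.
by apply: h; rewrite addn_gt0 le orbT.
Qed.

Lemma ready_same a L c c' : ready (a :: L) c -> visited c' = visited c ->
  pool c' = pool c ->
  (forall v, v != [::] -> a = (Some (behead v), v) -> exists j, visited c (j :: v)) ->
  ready L c'.
Proof.
move=> [[tree pr] fr] V P ac; split; last first.
  by apply: fresh_ready_behead fr => [z|v]; rewrite V//; exact: ac.
split=> [j v|e]; first by have := tree j v; rewrite /= !visited_adds V.
rewrite /present /= visited_adds pool_adds V P.
have := pr e; rewrite /present /= visited_adds pool_adds mul1n => h le.
by apply: h; rewrite addn_gt0 le orbT.
Qed.

Lemma ready_open a L c j k : (j < D)%N -> ready (a :: L) c ->
  ready L (open_at (j :: a.2) k c).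
Proof.
move=> jD r; have [va _] := ready_present r; move: r => [[tree pr] fr]; split; last first.
  apply: fresh_ready_behead fr => [z /= ->|v v0 aE]; first by rewrite orbT.
  by exists j; rewrite aE /= eqxx.
split=> [l v|e].
  rewrite visited_adds /= => /orP[/eqP[-> ->]|vl].
    by rewrite va orbT.
  by have := tree l v; rewrite /= visited_adds => /(_ vl)[-> ->]; rewrite orbT.
rewrite /present /= visited_adds pool_adds /= mul1n.
have [-> _|e1] := eqVneq e (Some a.2, j :: a.2).
  by split => /=; rewrite ?eqxx// => u [<-]; rewrite va orbT.
have [-> _|e2] := eqVneq e (None, j :: a.2).
  by split => //=; rewrite ?eqxx.
rewrite muln0 !add0n => le.
have := pr e; rewrite /present /= visited_adds pool_adds mul1n addn_gt0 le orbT.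
by case=> // v1 v2; split=> [|u /v2 ->]; rewrite ?v1 orbT.
Qed.

Context (R : realType) (nu : probability nat R) (p : R) (m : nat).
Hypothesis (p_gt0 : 0 < p) (p_lt_half : p < 2^-1) (D_ge2 : (2 <= D)%N).

Local Notation G := (supE nu p D.+1 m).

(** By induction the rest of the sweep is bounded by [G]; the move of the head is then raised to
    degree D + 1 and absorbed by superharmonicity. *)
Lemma sweepE_compare L c : ready L c -> (sweepE nu p D L G c <= G (adds L c))%E.
Proof.
have D1_ge2 : (2 <= D.+1)%N by exact: leqW.
have G0 : nonneg G by exact: supE_ge0.
elim: L c => [//|a L IH] c r.
have [va pa] := ready_present r.
apply: (@le_trans _ _ (moveE nu p D a (fun c' => G (adds L c')) c)).
  apply: lee_sum => -[i iD] _ /=.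
  (* Only an inward move of an activator could destroy [ready], and it has weight 0; null moves are
     therefore discarded first. *)
  have [->|w0] := eqVneq (move_weight p D a i) 0; first by rewrite !mul0e.
  apply: lee_wpmul2l; first by rewrite lee_fin move_weight_ge0.
  case: i iD w0 => [_|j jD _] /=; last first.
    case: ifP => vj; last first.
      apply: nuE_le => k; first by apply: sweepE_ge0.
      by apply: IH; apply: ready_open.
    apply: IH; apply: ready_same r _ _ _ => // v v0 aE.
    by exists j; move: vj; rewrite aE.
  rewrite /inward_weight => w0.
  have out v : v != [::] -> a = (Some (behead v), v) -> exists j, visited c (j :: v).
    move=> v0 aE; move: w0; rewrite aE /= ifF ?eqxx//.
    by apply/negP => /childrenP[j _ /(congr1 size)]; case: v v0 {aE} => //= k v _; lia.
  rewrite /parent_event; case: eqP => vr /=; apply: IH.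
    exact: ready_same r _ _ out.
  apply: (ready_appear r) => //; split => /= [|u [<-]//].
  move: r => [[tree _] _]; case: (a.2) va vr => //= k v kv _.
  by have := tree k v; rewrite /= visited_adds => /(_ kv)[].
(* The unmoved particles of [L] are back in the pool, so the two degrees are compared at one
   configuration, [adds L c]. *)
rewrite -moveE_adds//=.
have [sc fr] := r.
apply: le_trans (supE_moveE nu p_gt0 p_lt_half D1_ge2 m a (adds L c)).
apply: moveE_compare => //.
- split=> [j v|e]; first by have := sc.1 j v; rewrite /= visited_adds.
  have := sc.2 e; rewrite /present /= => h le.
  by apply: h; rewrite addn_gt0 le orbT.
- by split=> [|u]; rewrite visited_adds//; exact: pa.
- move=> a1 v0; rewrite visited_adds.
  case: a a1 v0 {r sc va pa} fr => [[//|] v] /= _ v0 fr.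
  by have [v1|//|] := fr [::] v L erefl; rewrite ?v1 // in v0 *.
Qed.

End Sweep.

(** * Independence of the sources of randomness *)

(** Countably many sources: conditions can be imposed on all of them at once and remain
    measurable. *)
Definition source_code d (s : source d) : vertex d + (frog d + vertex d * nat) :=
  match s with
  | Sleepers v => inl v
  | Walk f => inr (inl f)
  | Tie x m => inr (inr (x, m))
  end.

Definition source_decode d (c : vertex d + (frog d + vertex d * nat)) : source d :=
  match c with
  | inl v => Sleepers v
  | inr (inl f) => Walk f
  | inr (inr xm) => Tie xm.1 xm.2
  end.

Lemma source_codeK d : cancel (@source_code d) (@source_decode d).
Proof. by case. Qed.

HB.instance Definition _ d := Countable.copy (source d) (can_type (@source_codeK d)).

Section Cylinders.
Context (R : realType) (d : nat) (p : R) (nu : probability nat R)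
  (dT : measure_display) (T : measurableType dT) (P : probability T R).
Variable X : SFM d p nu P.

Definition sigma (s : source d) : set (set T) :=
  source_sigma (sleepers X) (walk X) (tie X) s.

Lemma sigma_algebra_sigma s : sigma_algebra setT (sigma s).
Proof.
case: s => [v|f|x m] /=; [|exact: smallest_sigma_algebra|];
  exact: sigma_algebra_preimage (@sigma_algebra_measurable _ _).
Qed.

Lemma sigma_setT s : sigma s setT.
Proof. by have [s0 sC _] := sigma_algebra_sigma s; rewrite -(setD0 setT); exact: sC. Qed.

Lemma sigma_setI s A B : sigma s A -> sigma s B -> sigma s (A `&` B).
Proof.
have [s0 sC sU] := sigma_algebra_sigma s => sA sB.
rewrite -[A `&` B]setCK setCI -setTD -bigcup2E; apply: (sC); apply: sU => -[|[|n]] //=.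
- by rewrite -setTD; apply: (sC).
- by rewrite -setTD; apply: (sC).
Qed.

Lemma sigma_measurable s : sigma s `<=` measurable.
Proof.
case: s => [v|f|x m] /=.
- by move=> _ [B mB <-]; exact: measurable_funPT.
- apply: smallest_sub; first exact: sigma_algebra_measurable.
  by move=> A [n _ [B mB <-]]; exact: measurable_funPT.
- by move=> _ [B mB <-]; exact: measurable_funPT.
Qed.

Lemma sigma_walk f i y : sigma (Walk f) [set t | walk X f i t = y].
Proof.
apply: sub_gen_smallest; exists i => //; exists [set y] => //.
by rewrite setTI.
Qed.

Lemma sigma_sleepers v k : sigma (Sleepers v) [set t | sleepers X v t = k].
Proof. by exists [set k] => //; rewrite setTI. Qed.

Lemma sigma_tie x m r : sigma (Tie x m) [set t | tie X x m t = r].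
Proof. by exists [set r] => //; rewrite setTI. Qed.

Definition cyl (A : source d -> set T) : set T := [set t | forall s, A s t].

(** Outside a finite list the conditions are almost sure rather than void: the starting points of
    all walks are prescribed together, and their law gives them only up to null sets. *)
Definition adapted (A : source d -> set T) : Prop :=
  (forall s, sigma s (A s)) /\
  exists J : seq (source d), forall s, s \notin J -> P (A s) = 1%:E.

Definition refine (A : source d -> set T) (s0 : source d) (B : set T) :
    source d -> set T :=
  fun s => if s == s0 then A s `&` B else A s.

Lemma cyl_refine A s B : cyl (refine A s B) = cyl A `&` B.
Proof.
apply/seteqP; split => [t h|t [h Bt] s' /=]; last first.
  by rewrite /refine; case: eqP => // _; split => //; exact: h.
split => [s'|]; last by have := h s; rewrite /refine eqxx => -[].
by have := h s'; rewrite /refine; case: eqP => // _ [].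
Qed.

Lemma adapted_refine A s B : adapted A -> sigma s B -> adapted (refine A s B).
Proof.
move=> [sA [J AJ]] sB; split=> [s'|].
  by rewrite /refine; case: eqP => // ->; exact: sigma_setI.
exists (s :: J) => s'; rewrite inE negb_or => /andP[/negbTE s's /AJ].
by rewrite /refine s's.
Qed.

Lemma measurable_cyl A : adapted A -> measurable (cyl A).
Proof.
move=> [sA _].
rewrite (_ : cyl A = ~` \bigcup_(s in [set: source d]) ~` A s); last first.
  by rewrite setC_bigcup; apply/seteqP; split => t h s => [_|]; have := h s;
    rewrite ?setCK//; apply.
apply: measurableC; apply: countable_bigcupT_measurable => [|s]; first exact: countableP.
by apply: measurableC; exact: sigma_measurable (sA s).
Qed.

(** Independence treats the sources of [J]; all others together exclude only a countable union of
    null sets. *)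
Lemma P_cyl A J : adapted A -> uniq J -> (forall s, s \notin J -> P (A s) = 1%:E) ->
  P (cyl A) = (\prod_(s <- J) fine (P (A s)))%:E.
Proof.
move=> aA uJ AJ; have [sA _] := aA.
have mA s : measurable (A s) := sigma_measurable (sA s).
pose F := \bigcap_(k in [set: 'I_(size J)]) A (tnth (in_tuple J) k).
have mF : measurable F by apply: fin_bigcap_measurable => // k _; exact: mA.
have -> : P (cyl A) = P F.
  pose M n := if unpickle n is Some s then
    (if s \in J then set0 else ~` A s) else set0.
  pose N := \bigcup_n M n.
  have mM n : measurable (M n).
    rewrite /M; case: unpickle => // s; case: ifP => // _; exact: measurableC.
  have mN : measurable N by exact: bigcupT_measurable.
  have N0 : P N = 0%E.
    apply: (measure_negligible mN); apply: negligible_bigcup => n.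
    apply/negligibleP; first exact: mM.
    rewrite /M; case: unpickle => [s|]; last exact: measure0.
    case: ifPn => [_|/AJ As1]; first exact: measure0.
    by have := probability_setC P (mA s); rewrite As1 subee.
  apply/eqP; rewrite eq_le; apply/andP; split.
    apply: le_measure; rewrite ?inE//; first exact: measurable_cyl.
    by move=> t h k _; exact: h.
  rewrite -[leRHS](@measureU0 _ _ _ P (cyl A) N)//; last exact: measurable_cyl.
  apply: le_measure; rewrite ?inE//; first by apply: measurableU => //; exact: measurable_cyl.
  move=> t Ft; have [|nN] := pselect (N t); [by right|left => s].
  have [sJ|sJ] := boolP (s \in J).
    have iJ : (index s J < size J)%N by rewrite index_mem.
    have := Ft (Ordinal iJ) I.
    by rewrite (tnth_nth s) /= nth_index.
  apply: contrapT => As; apply: nN; exists (pickle s); first exact: I.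
  by rewrite /M pickleK (negbTE sJ).
rewrite (@source_indep _ _ _ _ _ _ _ X _ (fun k => tnth (in_tuple J) k)
  (fun k => A (tnth (in_tuple J) k))); first last.
- by move=> k; exact: sA.
- exact: (tuple_uniqP (in_tuple J) uJ).
by rewrite [in RHS]big_tnth.
Qed.

(** By independence, conditioning on the whole cylinder affects the source [s] only through
    [A s]. *)
Lemma P_cylI A s B (q : R) : adapted A -> sigma s B ->
  P (A s `&` B) = (P (A s) * q%:E)%E -> P (cyl A `&` B) = (P (cyl A) * q%:E)%E.
Proof.
move=> aA sB PB; have [sA [J0 AJ0]] := aA.
pose J := s :: [seq s' <- undup J0 | s' != s].
have uJ : uniq J by rewrite /= mem_filter eqxx filter_uniq// undup_uniq.
have AJ s' : s' \notin J -> s' != s /\ P (A s') = 1%:E.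
  rewrite inE mem_filter mem_undup; have [//|_] /= := eqVneq s' s.
  by move=> /AJ0.
rewrite -(cyl_refine A s B) (@P_cyl (refine A s B) J _ uJ); first last.
- by move=> s' /AJ[/negbTE ss] ; rewrite /refine ss.
- exact: adapted_refine.
rewrite (P_cyl aA uJ); last by move=> s' /AJ[].
rewrite !big_cons /refine eqxx PB -EFinM; congr (_%:E).
rewrite fineM//; last by apply: fin_num_measure; exact: sigma_measurable (sA s).
rewrite /= mulrAC; congr (_ * _ * _); rewrite !big_filter; apply: eq_bigr => s' /negbTE.
by rewrite /refine => ->.
Qed.

End Cylinders.

(* The boolean tells the upper bound on the tail from the lower one; both have the
   same proof. *)
Definition cmp (R : realType) (b : bool) (x y : \bar R) : bool :=
  if b then (x <= y)%E else (y <= x)%E.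

(** * Conditioning on one more value of a source *)

Section Reveal.
Context (R : realType) (d : nat) (p : R) (nu : probability nat R)
  (dT : measure_display) (T : measurableType dT) (P : probability T R).
Variable X : SFM d p nu P.
Local Open Scope ereal_scope.

Lemma cmp_refl b (x : \bar R) : cmp b x x.
Proof. by case: b => /=. Qed.

Lemma cmp_trans b (x y z : \bar R) : cmp b x y -> cmp b y z -> cmp b x z.
Proof. by case: b => /= h1 h2; [exact: le_trans h2|exact: le_trans h1]. Qed.

Lemma cmp_sum b (C : eqType) (s : seq C) (F G : C -> \bar R) :
  (forall y, y \in s -> cmp b (F y) (G y)) ->
  cmp b (\sum_(y <- s) F y) (\sum_(y <- s) G y).
Proof.
by move=> FG; case: b FG => /= FG; rewrite !big_seq; apply: lee_sum.
Qed.

Lemma cmp_series b (F G : nat -> \bar R) : (forall k, 0 <= F k) -> (forall k, 0 <= G k) ->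
  (forall k, cmp b (F k) (G k)) ->
  cmp b (\sum_(0 <= k <oo) F k) (\sum_(0 <= k <oo) G k).
Proof.
by move=> F0 G0 FG; case: b FG => /= FG; apply: lee_nneseries => // k _; exact: FG.
Qed.

Section Values.
Context (C : eqType) (g : T -> C).
Hypothesis mg : forall y, measurable [set t | g t = y].

Lemma measurable_mem (ys : seq C) : measurable [set t | g t \in ys].
Proof.
elim: ys => [|y ys IH].
  by rewrite (_ : mkset _ = set0)//; apply/seteqP; split.
rewrite (_ : mkset _ = [set t | g t = y] `|` [set t | g t \in ys]).
  by apply: measurableU.
apply/seteqP; split => t /=; rewrite inE.
  by move=> /orP[/eqP|]; [left|right].
by move=> [->|->]; rewrite ?eqxx ?orbT.
Qed.

Lemma P_mem D (ys : seq C) : measurable D -> uniq ys ->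
  P (D `&` [set t | g t \in ys]) = \sum_(y <- ys) P (D `&` [set t | g t = y]).
Proof.
move=> mD; elim: ys => [_|y ys IH /= /andP[yys uys]].
  by rewrite big_nil (_ : _ `&` _ = set0) ?measure0//; apply/seteqP; split => t [].
rewrite big_cons -IH//.
rewrite [X in P X = _](_ : _ = (D `&` [set t | g t = y]) `|` (D `&` [set t | g t \in ys])).
  rewrite measureU; [by []|by apply: measurableI| |].
    by apply: measurableI => //; exact: measurable_mem.
  by apply/seteqP; split => t // [[_ /= gy] [_ /= gys]]; rewrite -gy gys in yys.
apply/seteqP; split => t /=; rewrite inE.
  by move=> [Dt /orP[/eqP|]]; [left|right].
by move=> [[Dt ->]|[Dt ->]]; rewrite ?eqxx ?orbT.
Qed.

End Values.

(** Total probability: bounds given each value of [g] are averaged with its conditional law [q].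
    Values outside [ys] have conditional probability 0 because [q] sums to 1 on [ys]. *)
Lemma reveal_finite b A s (C : eqType) (g : T -> C) (ys : seq C) (q : C -> R)
    (V : C -> \bar R) (E : set T) :
  adapted X A -> (forall y, sigma X s [set t | g t = y]) -> uniq ys ->
  (forall y, (0 <= q y)%R) ->
  (forall y, y \in ys -> P (A s `&` [set t | g t = y]) = P (A s) * (q y)%:E) ->
  (\sum_(y <- ys) q y = 1)%R -> measurable E -> (forall y, 0 <= V y) ->
  (forall y, y \in ys -> let A' := refine A s [set t | g t = y] in
     cmp b (P (cyl A' `&` E)) (P (cyl A') * V y)) ->
  cmp b (P (cyl A `&` E)) (P (cyl A) * \sum_(y <- ys) (q y)%:E * V y).
Proof.
move=> aA sg uys q0 Pq q1 mE V0 h.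
have mg y : measurable [set t | g t = y] by exact: (sigma_measurable (sg y)).
have mA := measurable_cyl aA.
have PAg y : y \in ys -> P (cyl A `&` [set t | g t = y]) = P (cyl A) * (q y)%:E.
  by move=> /Pq; apply: (P_cylI aA); exact: sg.
have Pys : P (cyl A `&` [set t | g t \in ys]) = P (cyl A).
  rewrite P_mem// big_seq (eq_bigr (fun y => P (cyl A) * (q y)%:E)); last exact: PAg.
  by rewrite -big_seq -ge0_sume_distrr ?sumEFin ?q1 ?mule1// => y _; rewrite lee_fin.
have P0 : P (cyl A `\` [set t | g t \in ys]) = 0.
  rewrite measureD//; last by rewrite ltey_eq fin_num_measure.
    by rewrite [X in _ - X]Pys subee// fin_num_measure.
  exact: measurable_mem.
have -> : P (cyl A `&` E) = \sum_(y <- ys) P (cyl A `&` E `&` [set t | g t = y]).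
  rewrite -P_mem//; last exact: measurableI.
  rewrite (measureDI P (B := [set t | g t \in ys])) //; last 2 first.
  - exact: measurableI.
  - exact: measurable_mem.
  rewrite [X in X + _](_ : _ = 0) ?add0e//.
  apply: (subset_measure0 _ _ _ P0).
  - by apply: measurableD; [exact: measurableI|exact: measurable_mem].
  - by apply: measurableD => //; exact: measurable_mem.
  - by move=> t [[At _] ?].
rewrite ge0_sume_distrr; last by move=> y _; apply: mule_ge0; rewrite ?lee_fin.
apply: cmp_sum => y yys; have /= := h _ yys; rewrite !cyl_refine PAg// -muleA.
by rewrite setIAC.
Qed.

Lemma reveal_nat b A s (g : T -> nat) (V : nat -> \bar R) (E : set T) :
  adapted X A -> (forall k, sigma X s [set t | g t = k]) ->
  (forall k, P (A s `&` [set t | g t = k]) = P (A s) * nu [set k]) ->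
  measurable E -> (forall k, 0 <= V k) ->
  (forall k, let A' := refine A s [set t | g t = k] in
     cmp b (P (cyl A' `&` E)) (P (cyl A') * V k)) ->
  cmp b (P (cyl A `&` E)) (P (cyl A) * nuE nu V).
Proof.
move=> aA sg Pq mE V0 h.
have nuf k : nu [set k] = (fine (nu [set k]))%:E.
  by rewrite fineK//; exact: fin_num_measure.
have mg k : measurable [set t | g t = k] by exact: (sigma_measurable (sg k)).
have mA := measurable_cyl aA.
have PAg k : P (cyl A `&` [set t | g t = k]) = P (cyl A) * nu [set k].
  by rewrite nuf; apply: (P_cylI aA (sg k)); rewrite -nuf; exact: Pq.
have -> : P (cyl A `&` E) = \sum_(0 <= k <oo) P (cyl A `&` E `&` [set t | g t = k]).
  have mB k : measurable (cyl A `&` E `&` [set t | g t = k]).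
    by apply: measurableI => //; exact: measurableI.
  rewrite -measure_semi_bigcup//; last 2 first.
  - by move=> i j _ _ [t [[_ /= ti] [_ /= tj]]]; rewrite -ti -tj.
  - exact: bigcupT_measurable.
  congr (P _); apply/seteqP; split => [t At|t [k _ []]//].
  by exists (g t).
have -> : P (cyl A) * nuE nu V =
    \sum_(0 <= k <oo) P (cyl A) * nu [set k] * V k.
  rewrite nuE_series//.
  have PAf : P (cyl A) = (fine (P (cyl A)))%:E.
    by rewrite fineK//; exact: fin_num_measure.
  rewrite PAf -nneseriesZl; last by move=> k _; exact: mule_ge0.
  by apply: eq_eseriesr => k _; rewrite muleA.
apply: cmp_series => k; [by []|by rewrite !mule_ge0|].
by have /= := h k; rewrite !cyl_refine PAg setIAC.
Qed.

(** The Markov property, obtained from the path probabilities of [x] and of its extension by [y]. *)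
Lemma P_walk A f k (x : nat -> vertex d) y :
  A (Walk f) = [set t | forall i, (i <= k)%N -> walk X f i t = x i] ->
  P (A (Walk f) `&` [set t | walk X f k.+1 t = y]) =
  P (A (Walk f)) * (step_prob p (if k is k'.+1 then Some (x k') else None) (x k) y)%:E.
Proof.
move=> ->; pose x' i := if i == k.+1 then y else x i.
rewrite (_ : _ `&` _ = [set t | forall i, (i <= k.+1)%N -> walk X f i t = x' i]).
  have := @walk_law _ _ _ _ _ _ _ X f x' k.+1; rewrite /= => ->.
  have := @walk_law _ _ _ _ _ _ _ X f x k; rewrite /= => ->.
  rewrite -EFinM /walk_prob big_nat_recr//= mulrA; congr (_ * _)%:E; last first.
    rewrite /x' eqxx !ltn_eqF//; case: k {x'} => // k.
    by rewrite ltn_eqF// ltnW.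
  congr (_ * _)%R; apply: eq_big_nat => i /andP[_ ik].
  rewrite /x' !ltn_eqF//; last by rewrite ltnW.
  by case: i ik => // i ik; rewrite ltn_eqF// !ltnS ltnW// ltnW.
apply/seteqP; split => [t [/= h hy] i|t /= h].
  by rewrite /x'; case: eqP => [->//|/eqP ik ik']; apply: h; rewrite -ltnS ltn_neqAle ik.
split => [i ik|]; last by rewrite h// /x' eqxx.
by rewrite h ?leqW// /x' ltn_eqF.
Qed.

End Reveal.

(** * Transition probabilities of the model *)

Definition emb d (v : vertex d) : word := map (@nat_of_ord d) v.

Lemma emb_inj d : injective (@emb d).
Proof. exact: inj_map (@ord_inj d). Qed.

Lemma behead_emb d (v : vertex d) : behead (emb v) = emb (parent v).
Proof. by case: v. Qed.

Lemma emb_root d (v : vertex d) : (emb v == [::]) = (v == Defs.root).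
Proof. by case: v. Qed.

Definition emb_particle d (a : option (vertex d) * vertex d) : particle :=
  (omap (@emb d) a.1, emb a.2).

Definition neighbours d (v : vertex d) : seq (vertex d) :=
  parent v :: [seq (j :: v : vertex d) | j <- enum 'I_d].

Lemma child_neq_parent d (j : 'I_d) (v : vertex d) : (j :: v : vertex d) != parent v.
Proof.
apply/eqP => /(congr1 size); rewrite /parent size_behead /=.
by move=> h; have := leq_pred (size v); rewrite -h ltnn.
Qed.

Lemma parent_child_neq d (v : vertex d) : is_child v (parent v) = false.
Proof.
rewrite /is_child; case: v => [|i [|j v]] //=.
apply/eqP => /(congr1 size) /= h; have := ltnn (size v).
by rewrite {2}h ltnS ltnW.
Qed.

Lemma uniq_neighbours d (v : vertex d) : uniq (neighbours v).
Proof.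
rewrite /= map_inj_uniq ?enum_uniq ?andbT => [|i j []//].
by apply/mapP => -[j _ /esym/eqP]; apply/negP/child_neq_parent.
Qed.

Lemma neighboursP d (v y : vertex d) : y \in neighbours v ->
  y = parent v \/ exists j : 'I_d, y = j :: v.
Proof. by rewrite inE => /orP[/eqP|/mapP[j _]]; [left|right; exists j]. Qed.

Lemma mem_children_emb d (u v : vertex d) :
  (emb u \in children d (emb v)) = is_child v u.
Proof.
apply/childrenP/idP => [[j jd]|].
  case: u => // i u [_ /emb_inj ->]; by rewrite /is_child /= eqxx.
case: u => // i u /eqP /= <-; exists i => //.
Qed.

Section Kernel.
Context (R : realType) (nu : probability nat R) (p : R) (d : nat).
Hypothesis (p_gt0 : 0 < p) (p_lt_half : p < 2^-1) (d_ge2 : (2 <= d)%N).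
Variables (prev : option (vertex d)) (v : vertex d).

Lemma step_prob_ge0 y : 0 <= step_prob p prev v y.
Proof.
have ps0 := pstar_ge0 p_gt0 p_lt_half d_ge2.
have ps1 := pstar_le1 p_lt_half d_ge2.
have ph0 := phat_ge0 p_gt0 p_lt_half.
have ph1 := phat_le1 p_lt_half.
have d1 : (1 : R) <= d%:R by rewrite ler1n ltnW.
rewrite /step_prob; case: prev => [u|]; do ![case: ifP => _] => //;
  rewrite ?invr_ge0 ?ler0n//; apply: divr_ge0; by rewrite ?subr_ge0 ?ler0n.
Qed.

Hypothesis moving : prev -> v != Defs.root.

(** [moving] excludes the conventional stay at the root. Away from it the two encodings of an inward
    last step agree: [v] is the parent of [u], and [u] is a child of [v]. *)
Lemma step_prob_parent :
  step_prob p prev v (parent v) = inward_weight p d (emb_particle (prev, v)).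
Proof.
move: moving; case: prev => [u|] /= mv; rewrite /inward_weight /=.
  rewrite (negbTE (mv isT)) mem_children_emb /is_child eqxx eq_sym.
  have -> : (u != Defs.root) && (parent u == v) = (parent u == v).
    by rewrite andb_idl// => /eqP uv; apply: contraNneq (mv isT) => ur; rewrite -uv ur.
  by case: ifP => // _; have := parent_child_neq v; rewrite /is_child => ->.
rewrite emb_root; case: eqP => [->|_]; last by rewrite eqxx.
by rewrite parent_child_neq.
Qed.

Lemma step_prob_child (j : 'I_d) :
  step_prob p prev v (j :: v) = outward_weight p d (emb_particle (prev, v)) j.
Proof.
have ch : is_child v (j :: v : vertex d) by rewrite /is_child /= eqxx.
move: moving; case: prev => [u|] /= mv; rewrite /outward_weight /=; last first.
  by rewrite emb_root (negbTE (child_neq_parent j v)) ch.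
have uch : is_child v u = (v == parent u).
  rewrite /is_child (eq_sym v) andb_idl// => /eqP uv.
  by apply: contraNneq (mv isT) => ur; rewrite -uv ur.
rewrite (negbTE (mv isT)) mem_children_emb uch (negbTE (child_neq_parent j v)) ch /=.
case: ifP => // _.
have -> : ((j : nat) :: emb v == emb u) = ((j :: v : vertex d) == u).
  by rewrite -[_ :: emb v]/(emb (j :: v)) (inj_eq (@emb_inj d)).
by case: eqP.
Qed.

Definition neighbour_event (y : vertex d) : event :=
  if y == parent v then parent_event (emb v) else Enter (emb y).

Lemma moveE_neighbours F c :
  moveE nu p d (emb_particle (prev, v)) F c =
  (\sum_(y <- neighbours v) (step_prob p prev v y)%:E * eventE nu (neighbour_event y) F c)%E.
Proof.
rewrite /moveE big_ord_recl /neighbours big_cons big_map big_enum /=.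
rewrite step_prob_parent /neighbour_event eqxx; congr (_ + _)%E.
apply: eq_bigr => j _; rewrite step_prob_child.
by rewrite (negbTE (child_neq_parent j v)) add0n.
Qed.

Lemma sum_step_prob : \sum_(y <- neighbours v) step_prob p prev v y = 1.
Proof.
rewrite -(sum_move_weight p d_ge2 (emb_particle (prev, v))) big_ord_recl.
rewrite /neighbours big_cons big_map big_enum /= step_prob_parent; congr (_ + _).
by apply: eq_bigr => j _; rewrite step_prob_child add0n.
Qed.

End Kernel.

(** * One step of the process, particle by particle *)

Definition bare d (V : seq (vertex d)) (n : nat) : config :=
  Config (fun x => x \in map (@emb d) V) (fun=> 0%N) n.

Lemma adds_bare_eq d (V V' : seq (vertex d)) L L' n : perm_eq L L' -> V =i V' ->
  adds L (bare V n) = adds L' (bare V' n).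
Proof.
move=> /seq.permP LL' VV'; rewrite (config_eta (adds L _)) (config_eta (adds L' _)).
rewrite !visited_adds !visits_adds; congr Config.
  by apply/funext => x /=; exact: eq_mem_map.
by apply/funext => b; rewrite !pool_adds LL'.
Qed.

Section World.
Variables (d : nat) (eta : vertex d -> nat) (w : frog d -> nat -> vertex d)
  (rank : vertex d -> nat -> nat).
Implicit Types (V : seq (vertex d)) (l : seq (frog d * nat)) (s : state d).

Definition prev_position (a : frog d * nat) : option (vertex d) :=
  if a.2 is k.+1 then Some (w a.1 k) else None.

Definition ptype (a : frog d * nat) : particle :=
  emb_particle (prev_position a, position w a).

Definition outs l : seq (vertex d) := [seq target w a | a <- l & ~~ inward w a].

(** [undup] keeps last occurrences, so with [rev] a further particle either leaves this list alone
    or puts its target in front. *)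
Definition born V l : seq (vertex d) := undup (rev [seq z <- outs l | z \notin V]).

Definition landed l : seq particle :=
  [seq (Some (emb (position w a)), emb (target w a)) |
    a <- l & inward w a && (target w a != Defs.root)].

Definition hatched (z : vertex d) : seq particle :=
  (Some (behead (emb z)), emb z) :: nseq (eta z) (None, emb z).

(* The configuration once the particles of l have moved, in a step begun with the
   vertices of V visited; how ties are broken is irrelevant to it. *)
Definition midway V (n : nat) l : config :=
  adds (landed l ++ flatten (map hatched (born V l)))
    (bare (born V l ++ V) (n + count (fun a => target w a == Defs.root) l)).

Lemma mem_born V l z :
  (z \in born V l) = (z \notin V) && (z \in outs l).
Proof. by rewrite mem_undup mem_rev mem_filter. Qed.

(** Simultaneous moves become successive events: the first contender for a vertex opens it and later
    ones find it visited, so exactly one continues, as after a tie. *)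
Lemma midway_rcons V n l a : target w a \in neighbours (position w a) ->
  let v := position w a in let y := target w a in
  midway V n (rcons l a) =
  if y == parent v then
    if y == Defs.root then add_visit (midway V n l)
    else add_particles 1 (Some (emb v), emb y) (midway V n l)
  else if y \in born V l ++ V then midway V n l
  else open_at (emb y) (eta y) (midway V n l).
Proof.
move=> nb v y.
have inE' : inward w a = (y == parent v) by [].
rewrite /midway /landed filter_rcons inE' -!/y.
have cnt : count (fun b => target w b == Defs.root) (rcons l a) =
    ((y == Defs.root) + count (fun b => target w b == Defs.root) l)%N.
  by rewrite -cats1 count_cat /= addn0 addnC.
rewrite cnt; case: eqP => [yv|yv] /=.
  have -> : born V (rcons l a) = born V l.
    by rewrite /born /outs filter_rcons inE' (introT eqP yv).
  case: (y =P Defs.root) => [yr|yr] /=.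
    rewrite (config_eta (add_visit _)) (config_eta (adds _ _)) /=.
    rewrite (config_eta (adds _ _)) /add_visit !visited_adds !visits_adds.
    congr Config; last by rewrite /= addnCA add1n.
    by apply/funext => b; rewrite !pool_adds.
  rewrite map_rcons -/y -/v add0n -[RHS]/(adds (_ :: _) _).
  by apply: adds_bare_eq => //; rewrite -cats1 -catA perm_catCA /=.
have yr : (y == Defs.root) = false.
  by case/neighboursP: nb => [/yv//|[j]]; rewrite -/y => ->.
have outsE : outs (rcons l a) = rcons (outs l) y.
  by rewrite /outs filter_rcons inE' (introF eqP yv) map_rcons.
have bornE : born V (rcons l a) = if y \in born V l ++ V then born V l else y :: born V l.
  rewrite /born outsE filter_rcons mem_cat mem_born.
  have [yV|yV] := boolP (y \in V); first by [].
  by rewrite rev_rcons /= mem_rev mem_filter yV orbF.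
rewrite bornE yr add0n; case: ifPn => // yB.
rewrite (config_eta (adds _ _)) [RHS](config_eta) /open_at /mark /=.
rewrite !visited_adds !visits_adds; congr Config.
  apply/funext => b; rewrite !pool_adds /= !count_cat /= count_cat count_nseq /=.
  by rewrite !(eq_sym b) mul1n !addn0 addnCA (addnCA (count_mem b _)) (mulnC (eta y)).
Qed.

End World.

(** In a state the survivors precede the newly activated particles; this places every survivor
    before a given new particle. *)
Lemma sub_prefix (A : eqType) (S F L1 L2 : seq A) x :
  S ++ F = L1 ++ x :: L2 -> x \notin S -> {subset S <= L1}.
Proof.
elim: S L1 => [|a S IH] [|b L1] //=.
  by move=> [->]; rewrite inE eqxx.
move=> [-> E]; rewrite inE negb_or => /andP[_ /(IH _ E) SL] y.
by rewrite !inE => /orP[->//|/SL ->]; rewrite orbT.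
Qed.

Section World.
Variables (d : nat) (eta : vertex d -> nat) (w : frog d -> nat -> vertex d)
  (rank : vertex d -> nat -> nat).
Hypothesis w0 : forall f, w f 0%N = f.1.

Record wf (s : state d) : Prop := Wf {
  wf_uniq : uniq (map fst s.2);
  wf_root : Defs.root \in s.1;
  wf_parent : forall v, v \in s.1 -> parent v \in s.1;
  wf_home : forall a, a \in s.2 -> a.1.1 \in s.1;
  wf_position : forall a, a \in s.2 -> position w a \in s.1;
  wf_prev : forall a v, a \in s.2 -> prev_position w a = Some v -> v \in s.1;
  wf_moving : forall a, a \in s.2 -> prev_position w a -> position w a != Defs.root;
  wf_fresh : fresh_ready (map (ptype w) s.2) (bare s.1 0) }.

Lemma wf_ready s n : wf s -> ready d (map (ptype w) s.2) (bare s.1 n).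
Proof.
move=> W; split; last exact: wf_fresh W.
split=> [j v|a]; rewrite /present !visited_adds ?pool_adds /=.
  case/mapP=> -[//|i u] us [-> ->]; split; first exact: ltn_ord.
  by apply: map_f; exact: (wf_parent W us).
rewrite addn0 -has_count has_pred1 => /mapP[b bs ->] /=; split.
  by apply: map_f; exact: wf_position.
move=> u; case pb: (prev_position w b) => [z|] //= [<-].
by apply: map_f; exact: wf_prev pb.
Qed.

Variable s : state d.
Hypothesis W : wf s.
Hypothesis nb : forall a, a \in s.2 -> target w a \in neighbours (position w a).
Hypothesis rk : forall z, z \in born w s.1 s.2 ->
  (rank z (size (contenders w s z)) < size (contenders w s z))%N.

Local Notation newly := (newly_visited w rank s).
Local Notation surv := (survives w rank s).

Let uniq_s2 : uniq s.2. Proof. exact: map_uniq (wf_uniq W). Qed.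

Let inward_visited a : a \in s.2 -> inward w a -> target w a \in s.1.
Proof.
move=> as2 /eqP ->; apply: (wf_parent W); exact: wf_position.
Qed.

Let outward_position a : a \in s.2 -> ~~ inward w a ->
  position w a = parent (target w a).
Proof.
move=> as2 na; case/neighboursP: (nb as2) => [h|[j ->]//].
by rewrite /inward h eqxx in na.
Qed.

(** The winners of the ties, one for each vertex of [born]. *)
Let openers := [seq a <- s.2 | surv a & ~~ inward w a].

Let openersP a : a \in openers ->
  [/\ a \in s.2, ~~ inward w a, target w a \notin s.1 &
  index a (contenders w s (target w a)) =
  rank (target w a) (size (contenders w s (target w a)))].
Proof.
rewrite mem_filter => /andP[/andP[/andP[_ +] na] as2].
by rewrite (negbTE na) /= => /andP[-> /eqP ->].
Qed.

Let openers_inj : {in openers &, injective (target w)}.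
Proof.
move=> a b /openersP[a2 na _ ia] /openersP[b2 nb' _ ib] ab.
have aC : a \in contenders w s (target w a) by rewrite mem_filter na eqxx.
have bC : b \in contenders w s (target w a) by rewrite mem_filter nb' ab eqxx.
by rewrite -(nth_index a aC) ia ab -ib -ab nth_index.
Qed.

Let openers_uniq : uniq (map (target w) openers).
Proof. by rewrite map_inj_in_uniq// filter_uniq. Qed.

Let openers_born : map (target w) openers =i born w s.1 s.2.
Proof.
move=> z; apply/mapP/idP => [[a /openersP[a2 na nt _] ->]|zb].
  by rewrite mem_born nt; apply: map_f; rewrite mem_filter na.
have /[1!mem_born]/andP[zV /mapP[b]] := zb.
rewrite mem_filter => /andP[nb' b2] zE.
have bC : b \in contenders w s z by rewrite mem_filter nb' zE eqxx.
pose a := nth b (contenders w s z) (rank z (size (contenders w s z))).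
have aC : a \in contenders w s z by apply: mem_nth; exact: rk.
move: (aC); rewrite mem_filter => /andP[/andP[na /eqP ta] a2].
exists a => //; rewrite mem_filter a2 na andbT /survives ta zV.
rewrite index_uniq ?filter_uniq ?eqxx ?rk// orbT andbT.
by rewrite ?andbT; apply/negP => /eqP zr; move: zV; rewrite zr (wf_root W).
Qed.

Lemma newly_openers : newly =i map (target w) openers.
Proof.
move=> z; rewrite mem_undup mem_filter; apply/andP/mapP.
  move=> [zV /mapP[a]]; rewrite mem_filter => /andP[sa a2] zE.
  exists a => //; rewrite mem_filter a2 sa /= andbT.
  by apply: contraNN zV => /(inward_visited a2); rewrite zE.
move=> [a ao zE]; have [a2 na nt _] := openersP ao; split; first by rewrite zE.
rewrite zE map_f// mem_filter a2 andbT.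
by move: ao; rewrite mem_filter => /andP[/andP[]].
Qed.

Lemma newly_born : newly =i born w s.1 s.2.
Proof. by move=> z; rewrite newly_openers openers_born. Qed.

Let newly_perm : perm_eq newly (map (target w) openers).
Proof. by apply: uniq_perm; [exact: undup_uniq|exact: openers_uniq|exact: newly_openers]. Qed.

Let stepped (a : frog d * nat) := (a.1, a.2.+1).

Let ptype_stepped a : ptype w (stepped a) = (Some (emb (position w a)), emb (target w a)).
Proof. by []. Qed.

Let hatching := [seq ((v, i), 0%N) | v <- newly, i <- iota 0 (eta v)].

Let survivors_perm : perm_eq (map (fun a => ptype w (stepped a)) [seq a <- s.2 | surv a])
  (landed w s.2 ++ [seq (Some (behead (emb z)), emb z) | z <- newly]).
Proof.
rewrite -(permPl (perm_map _ (permEl (perm_filterC (inward w) _)))) map_cat.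
apply: perm_cat.
  rewrite -filter_predI (_ : seq.filter _ _ =
    [seq a <- s.2 | inward w a && (target w a != Defs.root)])//.
  apply: eq_filter => a /=; rewrite /survives.
  by case: (inward w a) => //=; rewrite andbT.
rewrite (permPr (perm_map _ newly_perm)) -map_comp.
rewrite -filter_predI (_ : seq.filter _ _ = openers); last first.
  by apply: eq_filter => a /=; rewrite andbC.
rewrite (_ : map _ openers = map ((fun z => (Some (behead (emb z)), emb z)) \o target w) openers)//.
apply/eq_in_map => a /openersP[a2 na _ _].
by rewrite ptype_stepped (outward_position a2 na) /= behead_emb.
Qed.

Let ptype_hatching : map (ptype w) hatching =
  flatten [seq nseq (eta z) (None, emb z) | z <- newly].
Proof.
rewrite /hatching map_flatten -map_comp; congr flatten; apply: eq_map => z /=.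
rewrite -map_comp -[in RHS](size_iota 0 (eta z)).
elim: (iota 0 (eta z)) => //= i r ->; congr cons.
by rewrite /ptype /emb_particle /= /position w0.
Qed.

Let step2 : (step eta w rank s).2 = map stepped [seq a <- s.2 | surv a] ++ hatching.
Proof. by []. Qed.

Let step1 : (step eta w rank s).1 = newly ++ s.1.
Proof. by []. Qed.

Let perm_hatched (l : seq (vertex d)) :
  perm_eq (flatten (map (hatched eta) l))
   ([seq (Some (behead (emb z)), emb z) | z <- l] ++
    flatten [seq nseq (eta z) (None, emb z) | z <- l]).
Proof.
elim: l => //= z l IH; rewrite perm_cons perm_sym perm_catCA perm_cat2l perm_sym.
exact: IH.
Qed.

(** All contenders for [z] come from the parent of [z] and look alike after the move, so the
    identity of the winner disappears from the multiset. *)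
Lemma midway_step n :
  midway eta w s.1 n s.2 =
  adds (map (ptype w) (step eta w rank s).2)
    (bare (step eta w rank s).1 (n + arrivals w s)).
Proof.
apply: adds_bare_eq; last by move=> z; rewrite step1 !mem_cat newly_born.
rewrite step2 map_cat -map_comp ptype_hatching perm_sym.
rewrite (permPl (perm_cat survivors_perm (perm_refl _))) -catA perm_cat2l.
rewrite -(permPl (perm_hatched _)); apply: perm_flatten; apply: perm_map.
apply: uniq_perm; [exact: undup_uniq|exact: undup_uniq|exact: newly_born].
Qed.

Lemma wf_step : wf (step eta w rank s).
Proof.
have surv2 a : a \in [seq a <- s.2 | surv a] -> a \in s.2 /\ surv a.
  by rewrite mem_filter => /andP[].
have newV z : z \in newly -> z \notin s.1.
  by rewrite mem_undup mem_filter => /andP[].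
have hatchP a : a \in hatching ->
    exists v i, [/\ v \in newly, (i < eta v)%N & a = ((v, i), 0%N)].
  by case/allpairsPdep => v [i [vn]]; rewrite mem_iota => ie ->; exists v, i.
have newW a : a \in [seq a <- s.2 | surv a] -> target w a \in newly ++ s.1.
  move=> /[dup] aS /surv2[a2 sa]; rewrite mem_cat.
  have [//|na] := boolP (inward w a); first by move=> /(inward_visited a2) ->; rewrite orbT.
  by rewrite newly_openers map_f// mem_filter sa na.
split.
- rewrite step2 map_cat cat_uniq -map_comp; apply/and3P; split.
  + by apply: subseq_uniq (wf_uniq W); exact: (map_subseq fst (filter_subseq _ _)).
  + apply/hasPn => f /mapP[a /hatchP[v [i [vn _ ->]]] ->] /=.
    apply/mapP => -[b /surv2[b2 _] /= E].
    by have := wf_home W b2; rewrite -E /=; apply/negP; exact: newV.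
  + rewrite /hatching map_allpairs.
    apply: allpairs_uniq_dep; [exact: undup_uniq|by move=> v _; exact: iota_uniq|].
    by move=> [v i] [v' i'] _ _ /= [-> ->].
- by rewrite step1 mem_cat (wf_root W) orbT.
- move=> v; rewrite step1 !mem_cat => /orP[|/(wf_parent W) ->]; rewrite ?orbT//.
  rewrite newly_openers => /mapP[a /openersP[a2 na _ _] ->].
  by rewrite -(outward_position a2 na) wf_position ?orbT.
- move=> a; rewrite step2 step1 !mem_cat => /orP[/mapP[b /surv2[b2 _] ->]|].
    by rewrite /= wf_home ?orbT.
  by case/hatchP => v [i [vn _ ->]]; rewrite /= vn.
- move=> a; rewrite step2 => /[1!mem_cat]/orP[/mapP[b bS ->]|].
    exact: (newW b bS).
  by case/hatchP => v [i [vn _ ->]]; rewrite /position w0 step1 mem_cat vn.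
- move=> a v; rewrite step2 => /[1!mem_cat]/orP[/mapP[b /surv2[b2 _] ->] [<-]|].
    by rewrite step1 mem_cat (wf_position W b2) orbT.
  by case/hatchP => u [i [_ _ ->]].
- move=> a; rewrite step2 => /[1!mem_cat]/orP[/mapP[b /surv2[_ sb] ->] _|].
    by case/andP: sb.
  by case/hatchP => u [i [_ _ ->]].
- move=> L1 v L2; rewrite step2 map_cat -map_comp => E.
  have vS : (None, v) \notin map (fun a => ptype w (stepped a)) [seq a <- s.2 | surv a].
    by apply/mapP => -[].
  have : (None, v) \in map (ptype w \o stepped) [seq a <- s.2 | surv a] ++ map (ptype w) hatching.
    by rewrite E mem_cat inE eqxx orbT.
  rewrite mem_cat (negbTE vS) /= => /mapP[a /hatchP[z [i [zn _ ->]]]].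
  rewrite /ptype /emb_particle /= /position w0 /= => -[->].
  move: zn; rewrite newly_openers => /mapP[b bo ->]; have [b2 nib _ _] := openersP bo.
  (* The opener [b] of the vertex is a survivor that came from its parent, hence the required
     activator. *)
  apply: Or33; apply: (sub_prefix E vS); apply/mapP; exists b.
    by move: bo; rewrite !mem_filter => /andP[/andP[-> _] ->].
  by rewrite /= ptype_stepped (outward_position b2 nib) behead_emb.
Qed.

End World.

(** * Dependence of one step on the randomness that it reads *)

Section Agreement.
Variables (d : nat) (eta eta' : vertex d -> nat) (w w' : frog d -> nat -> vertex d)
  (rank rank' : vertex d -> nat -> nat).

Definition same_path (f : frog d) (k : nat) : Prop :=
  forall i, (i <= k)%N -> w f i = w' f i.

Lemma same_position a : same_path a.1 a.2 -> position w a = position w' a.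
Proof. exact. Qed.

Lemma same_prev a : same_path a.1 a.2 -> prev_position w a = prev_position w' a.
Proof. by case: a => f [|k] //= h; rewrite /prev_position /= h. Qed.

Lemma same_ptype a : same_path a.1 a.2 -> ptype w a = ptype w' a.
Proof. by move=> h; rewrite /ptype same_prev// same_position. Qed.

Lemma same_target a : same_path a.1 a.2.+1 -> target w a = target w' a.
Proof. exact. Qed.

Lemma same_inward a : same_path a.1 a.2.+1 -> inward w a = inward w' a.
Proof.
by move=> h; rewrite /inward same_target// same_position// => i ik; apply: h; exact: leqW.
Qed.

Variable l : seq (frog d * nat).
Hypothesis same_l : forall a, a \in l -> same_path a.1 a.2.+1.

Let pos a : a \in l -> position w a = position w' a.
Proof. by move=> /same_l h; apply: same_position => i ik; apply: h; exact: leqW. Qed.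

Lemma same_outs : outs w l = outs w' l.
Proof.
rewrite /outs (eq_in_filter (a2 := fun a => ~~ inward w' a)); last first.
  by move=> a /same_l al /=; rewrite same_inward.
by apply/eq_in_map => a; rewrite mem_filter => /andP[_ /same_l]; exact: same_target.
Qed.

Lemma same_born V : born w V l = born w' V l.
Proof. by rewrite /born same_outs. Qed.

Lemma same_landed : landed w l = landed w' l.
Proof.
rewrite /landed (eq_in_filter
  (a2 := fun a => inward w' a && (target w' a != Defs.root))); last first.
  by move=> a /same_l al /=; rewrite same_inward// same_target.
apply/eq_in_map => a; rewrite mem_filter => /andP[_ al].
by rewrite pos// same_target//; exact: same_l.
Qed.

Lemma same_contenders V x : contenders w (V, l) x = contenders w' (V, l) x.
Proof.
by apply: eq_in_filter => a /same_l al; rewrite same_inward// same_target.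
Qed.

Lemma same_arrivals V : arrivals w (V, l) = arrivals w' (V, l).
Proof. by apply: eq_in_count => a /same_l al; rewrite same_target. Qed.

Lemma same_midway V n : (forall z, z \in born w V l -> eta z = eta' z) ->
  midway eta w V n l = midway eta' w' V n l.
Proof.
move=> ee; rewrite /midway -same_landed -same_born.
have -> : map (hatched eta) (born w V l) = map (hatched eta') (born w V l).
  by apply/eq_in_map => z /ee; rewrite /hatched => ->.
congr (adds _ (bare _ (n + _))).
by apply: eq_in_count => a /same_l al; rewrite same_target.
Qed.

Lemma same_survives V a :
  (forall z, z \in born w V l ->
     let m := size (contenders w (V, l) z) in rank z m = rank' z m) ->
  a \in l -> survives w rank (V, l) a = survives w' rank' (V, l) a.
Proof.
move=> rr al; rewrite /survives -same_contenders.
rewrite -(same_target (same_l al)) -(same_inward (same_l al)).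
case ia: (inward w a) => //=; case ta: (target w a \in V) => //=.
rewrite rr// mem_born ta; apply: map_f.
by rewrite mem_filter ia.
Qed.

Lemma same_newly V :
  (forall z, z \in born w V l ->
     let m := size (contenders w (V, l) z) in rank z m = rank' z m) ->
  newly_visited w rank (V, l) = newly_visited w' rank' (V, l).
Proof.
move=> rr; rewrite /newly_visited /=; congr (undup (seq.filter _ _)).
rewrite (eq_in_filter (a2 := survives w' rank' (V, l))); last first.
  by move=> a al; exact: same_survives.
by apply/eq_in_map => a; rewrite mem_filter => /andP[_ /same_l]; exact: same_target.
Qed.

Lemma same_step V :
  (forall z, z \in born w V l ->
     let m := size (contenders w (V, l) z) in rank z m = rank' z m) ->
  (forall z, z \in newly_visited w rank (V, l) -> eta z = eta' z) ->
  step eta w rank (V, l) = step eta' w' rank' (V, l).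
Proof.
move=> rr ee; rewrite /step /= -same_newly//.
have -> : [seq a <- l | survives w rank (V, l) a] =
    [seq a <- l | survives w' rank' (V, l) a].
  by apply: eq_in_filter => a al; exact: same_survives.
congr (_, _ ++ flatten _).
by apply/eq_in_map => z /ee ->.
Qed.

End Agreement.

Lemma same_wf d (w w' : frog d -> nat -> vertex d) (s : state d) :
  (forall a, a \in s.2 -> same_path w w' a.1 a.2) -> wf w s -> wf w' s.
Proof.
move=> sm [u r pa ho po pr mo fr]; split => //.
- by move=> a a2; rewrite -(same_position (sm _ a2)); exact: po.
- by move=> a v a2; rewrite -(same_prev (sm _ a2)); exact: pr.
- move=> a a2; rewrite -(same_prev (sm _ a2)) -(same_position (sm _ a2)); exact: mo.
- rewrite (_ : map _ _ = map (ptype w) s.2)//.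
  by apply/eq_in_map => a a2; rewrite (same_ptype (sm _ a2)).
Qed.

(** * Revealing the randomness *)

Section Link.
Context (R : realType) (d : nat) (p : R) (nu : probability nat R)
  (dT : measure_display) (T : measurableType dT) (P : probability T R).
Variable X : SFM d p nu P.
Hypothesis (p_gt0 : 0 < p) (p_lt_half : p < 2^-1) (d_ge2 : (2 <= d)%N).

Definition walks (t : T) : frog d -> nat -> vertex d := fun f k => walk X f k t.
Definition sleeping (t : T) : vertex d -> nat := fun v => sleepers X v t.
Definition ranks (t : T) : vertex d -> nat -> nat := fun x m => tie X x m t.

Definition visits_before (n : nat) (t : T) : nat := \sum_(i < n) sfm_arrivals X i t.

Definition agree (t0 : T) (f : frog d) (k : nat) : set T :=
  [set t | same_path (walks t) (walks t0) f k].

Implicit Types (A : source d -> set T) (l : seq (frog d * nat)) (Z : seq (vertex d)).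

(* The information revealed so far, in the middle of step n: the event is cyl A,
   t0 is a point of it, the particles in l1 have been moved, those in l2 have
   not, and the ties have been broken at the vertices of Z. *)
Record known (n : nat) A (t0 : T) l1 l2 Z : Prop := Known {
  kn_adapted : adapted X A;
  kn_in : cyl A t0;
  kn_state : forall t, cyl A t -> sfm_state X n t = sfm_state X n t0;
  kn_visits : forall t, cyl A t -> visits_before n t = visits_before n t0;
  kn_start : forall f t, A (Walk f) t -> walks t f 0%N = f.1;
  kn_split : (sfm_state X n t0).2 = l1 ++ l2;
  kn_moved : forall a, a \in l1 -> A (Walk a.1) = agree t0 a.1 a.2.+1;
  kn_target : forall a, a \in l1 ->
    target (walks t0) a \in neighbours (position (walks t0) a);
  kn_unmoved : forall a, a \in l2 -> A (Walk a.1) = agree t0 a.1 a.2;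
  kn_asleep : forall f, f.1 \notin (sfm_state X n t0).1 ->
    A (Walk f) = [set t | walks t f 0%N = f.1];
  kn_unborn : forall z, z \notin (sfm_state X n t0).1 ->
    z \notin born (walks t0) (sfm_state X n t0).1 l1 -> A (Sleepers z) = setT;
  kn_born : forall z t, z \in born (walks t0) (sfm_state X n t0).1 l1 ->
    A (Sleepers z) t -> sleeping t z = sleeping t0 z;
  kn_untied : forall z m, z \notin (sfm_state X n t0).1 -> z \notin Z ->
    A (Tie z m) = setT;
  kn_tied : forall z, z \in Z ->
    let m := size (contenders (walks t0) ((sfm_state X n t0).1, l1) z) in
    [/\ z \in born (walks t0) (sfm_state X n t0).1 l1,
        (ranks t0 z m < m)%N &
        forall t, A (Tie z m) t -> ranks t z m = ranks t0 z m];
  kn_wf : wf (walks t0) (sfm_state X n t0) }.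

Lemma agree_trans t0 t1 f k : agree t0 f k t1 -> agree t1 f k = agree t0 f k.
Proof.
by move=> h; apply/seteqP; split => t /= ht i ik; rewrite ht// h.
Qed.

Lemma agree_same t0 t1 f k : agree t0 f k t1 -> same_path (walks t0) (walks t1) f k.
Proof. by move=> h i ik; rewrite h. Qed.

Lemma known_moved_same n A t0 l1 l2 Z t1 : known n A t0 l1 l2 Z -> cyl A t1 ->
  forall a, a \in l1 -> same_path (walks t0) (walks t1) a.1 a.2.+1.
Proof.
move=> K At1 a al; apply: agree_same; rewrite -(kn_moved K al); exact: At1.
Qed.

Lemma known_unmoved_same n A t0 l1 l2 Z t1 : known n A t0 l1 l2 Z -> cyl A t1 ->
  forall a, a \in l2 -> same_path (walks t0) (walks t1) a.1 a.2.
Proof.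
move=> K At1 a al; apply: agree_same; rewrite -(kn_unmoved K al); exact: At1.
Qed.

(** What is recorded is constant on [cyl A], so [t0] is only a reference point; it has to be changed
    when it lacks the value revealed next. *)
Lemma known_rebase n A t0 l1 l2 Z t1 : known n A t0 l1 l2 Z -> cyl A t1 ->
  known n A t1 l1 l2 Z.
Proof.
move=> K At1; have st := kn_state K At1.
have sm1 := known_moved_same K At1.
have sm2 := known_unmoved_same K At1.
have bE := same_born sm1 (sfm_state X n t0).1.
have cE := same_contenders sm1 (sfm_state X n t0).1.
case: K => ad inn sta vis start split_ moved targ unmoved asleep unborn bor untied tied w.
split; rewrite ?st -?bE.
- exact: ad.
- exact: At1.
- exact: sta.
- by move=> t At; rewrite vis// vis.
- exact: start.
- exact: split_.
- move=> a al; rewrite moved// (@agree_trans t0 t1)//; rewrite -moved//; exact: At1.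
- move=> a al; rewrite -(same_target (sm1 _ al)) -(same_position (w := walks t0)).
    exact: targ.
  by move=> i ik; apply: sm1 => //; exact: leqW.
- move=> a al; rewrite unmoved// (@agree_trans t0 t1)//; rewrite -unmoved//; exact: At1.
- exact: asleep.
- exact: unborn.
- move=> z t zb Az; rewrite (bor z t zb Az); apply/esym; apply: bor => //; exact: At1.
- exact: untied.
- move=> z zZ; have [zb zr zt] := tied z zZ; rewrite -cE.
  have e : ranks t1 z (size (contenders (walks t0) ((sfm_state X n t0).1, l1) z)) =
      ranks t0 z (size (contenders (walks t0) ((sfm_state X n t0).1, l1) z)).
    by apply: zt; exact: At1.
  by rewrite /= e; split => // t /zt.
- apply: same_wf w => a; rewrite split_ mem_cat => /orP[al i ik|/sm2//].
  by apply: sm1 => //; exact: leqW.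
Qed.

(** Live particles have distinct walks, so revealing a step of [a] leaves the information on the
    others untouched. *)
Lemma known_home_neq n A t0 l1 a l2 Z : known n A t0 l1 (a :: l2) Z ->
  forall b, b \in l1 ++ l2 -> b.1 != a.1.
Proof.
move=> K b bl; have := wf_uniq (kn_wf K); rewrite (kn_split K).
rewrite map_cat /= (perm_uniq (permEl (perm_catCA _ [:: a.1] _))) /= -map_cat => /andP[na _].
by apply: contraNneq na => <-; exact: map_f.
Qed.

(* A' also records the number of sleepers at the target if a opens it. *)
Lemma known_move n A t0 l1 a l2 A' : known n A t0 l1 (a :: l2) [::] ->
  let s := sfm_state X n t0 in
  let y := target (walks t0) a in
  y \in neighbours (position (walks t0) a) ->
  adapted X A' -> cyl A' t0 -> (forall t, cyl A' t -> cyl A t) ->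
  (forall f, A' (Walk f) = refine A (Walk a.1) [set t | walks t a.1 a.2.+1 = y] (Walk f)) ->
  (forall z m, A' (Tie z m) = A (Tie z m)) ->
  (forall z, A' (Sleepers z) = A (Sleepers z) \/
     [/\ z = y, z \in born (walks t0) s.1 (rcons l1 a) &
       forall t, A' (Sleepers z) t -> sleeping t z = sleeping t0 z]) ->
  (y \in born (walks t0) s.1 l1 ++ s.1 \/ inward (walks t0) a \/
     forall t, A' (Sleepers y) t -> sleeping t y = sleeping t0 y) ->
  known n A' t0 (rcons l1 a) l2 [::].
Proof.
move=> K s y nb ad inn sub AW AT AS Ay.
have neq := known_home_neq K.
have AWneq f : f != a.1 -> A' (Walk f) = A (Walk f).
  by move=> fa; rewrite AW /refine; case: eqP => // -[] E; rewrite E eqxx in fa.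
have ainl : a \in a :: l2 by rewrite inE eqxx.
have as2 : a \in s.2 by rewrite (kn_split K) mem_cat ainl orbT.
have bornr z : (z \in born (walks t0) s.1 (rcons l1 a)) =
    (z \in born (walks t0) s.1 l1) || [&& z \notin s.1, ~~ inward (walks t0) a & z == y].
  rewrite !mem_born /outs filter_rcons; case: ifP => ia /=; last by rewrite andbF orbF.
  by rewrite map_rcons mem_rcons inE; case: (z \notin s.1) => //=; rewrite orbC.
split => //.
- by move=> t /sub; exact: (kn_state K).
- by move=> t /sub; exact: (kn_visits K).
- by move=> f t; rewrite AW /refine; case: eqP => [_ [h _]|_ h]; exact: (kn_start K h).
- by rewrite (kn_split K) cat_rcons.
- move=> b; rewrite mem_rcons inE => /orP[/eqP ->|bl]; last first.
    by rewrite AWneq ?neq ?mem_cat ?bl// (kn_moved K).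
  rewrite AW /refine eqxx (kn_unmoved K ainl).
  apply/seteqP; split => [t [/= h hy] i|t h]; last first.
    by split => [i ik|]; apply: h => //; exact: leqW.
  by rewrite leq_eqVlt ltnS => /orP[/eqP ->//|]; exact: h.
- by move=> b; rewrite mem_rcons inE => /orP[/eqP -> //|]; exact: (kn_target K).
- move=> b bl; rewrite AWneq ?neq ?mem_cat ?bl ?orbT//.
  by apply: (kn_unmoved K); rewrite inE bl orbT.
- move=> f fs; rewrite AWneq ?(kn_asleep K fs)//.
  by apply: contraNneq fs => ->; exact: (wf_home (kn_wf K) as2).
- move=> z zs; rewrite bornr negb_or => /andP[zb nzy].
  case: (AS z) => [->|[_]]; first exact: (kn_unborn K).
  by rewrite bornr (negbTE zb) (negbTE nzy).
- move=> z t zb Azt; case: (AS z) => [E|[_ _]]; last exact.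
  move: zb; rewrite bornr => /orP[zb|/and3P[zs na /eqP zy]].
    by apply: (kn_born K zb); rewrite -E.
  case: Ay => [|[ia|h]]; last by rewrite zy; apply: h; rewrite -zy.
    rewrite -zy mem_cat (negbTE zs) orbF => zb.
    by apply: (kn_born K zb); rewrite -E.
  by rewrite ia in na.
- by move=> z m zs zZ; rewrite AT; exact: (kn_untied K).
- exact: (kn_wf K).
Qed.

Lemma known_tie n A t0 l1 Z z : known n A t0 l1 [::] Z ->
  let s := sfm_state X n t0 in
  let m := size (contenders (walks t0) (s.1, l1) z) in
  z \in born (walks t0) s.1 l1 -> (ranks t0 z m < m)%N ->
  known n (refine A (Tie z m) [set t | ranks t z m = ranks t0 z m]) t0 l1 [::] (z :: Z).
Proof.
move=> K s m zb rm; set A' := refine _ _ _.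
have sub t : cyl A' t -> cyl A t by rewrite cyl_refine => -[].
split => //.
- by apply: adapted_refine; [exact: (kn_adapted K)|exact: sigma_tie].
- by rewrite cyl_refine; split => //; exact: (kn_in K).
- by move=> t /sub; exact: (kn_state K).
- by move=> t /sub; exact: (kn_visits K).
- by move=> f t; exact: (kn_start K).
- exact: (kn_split K).
- exact: (kn_moved K).
- exact: (kn_target K).
- exact: (kn_asleep K).
- exact: (kn_unborn K).
- by move=> z' t; exact: (kn_born K).
- move=> z' m' zs; rewrite inE negb_or => /andP[zz zZ].
  rewrite /A' /refine; case: eqP => [[zE _]|_]; last exact: (kn_untied K).
  by rewrite zE eqxx in zz.
- move=> z' /[1!inE] /orP[/eqP ->|zZ].
    by split => // t; rewrite /A' /refine eqxx => -[].
  have [zb' zr' zt'] := kn_tied K zZ; split => // t.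
  by rewrite /A' /refine; case: eqP => _ => [[] /zt'|/zt'].
- exact: (kn_wf K).
Qed.

Lemma state_succ n t : sfm_state X n.+1 t =
  step (sleeping t) (walks t) (ranks t) (sfm_state X n t).
Proof. by []. Qed.

Lemma visits_succ n t : visits_before n.+1 t =
  (visits_before n t + arrivals (walks t) (sfm_state X n t))%N.
Proof. by rewrite /visits_before big_ord_recr. Qed.

Section NextStep.
Variables (n : nat) (A : source d -> set T) (t0 : T)
  (l1 : seq (frog d * nat)) (Z : seq (vertex d)).
Hypothesis K : known n A t0 l1 [::] Z.
Hypothesis tied : forall z, z \in born (walks t0) (sfm_state X n t0).1 l1 -> z \in Z.

Let s := sfm_state X n t0.
Let sE : s = (s.1, l1).
Proof. by move: (kn_split K); rewrite cats0 -/s; case: s => /= V l ->. Qed.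

Let s2 : (sfm_state X n t0).2 = l1.
Proof. by rewrite (kn_split K) cats0. Qed.

Let w0 f : walks t0 f 0%N = f.1.
Proof. by apply: (kn_start K); exact: (kn_in K). Qed.

Let nb a : a \in s.2 -> target (walks t0) a \in neighbours (position (walks t0) a).
Proof. by rewrite {1}sE; exact: (kn_target K). Qed.

Let rk z : z \in born (walks t0) s.1 s.2 ->
  (ranks t0 z (size (contenders (walks t0) s z)) < size (contenders (walks t0) s z))%N.
Proof. by rewrite sE => /tied zZ; have [] := kn_tied K zZ. Qed.

Let Wf := kn_wf K.

Lemma midway_next : midway (sleeping t0) (walks t0) s.1 (visits_before n t0) l1 =
  adds (map (ptype (walks t0)) (sfm_state X n.+1 t0).2)
    (bare (sfm_state X n.+1 t0).1 (visits_before n.+1 t0)).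
Proof.
rewrite state_succ visits_succ -/s -midway_step//; first by rewrite {3}sE.
Qed.

(** With the ties at all new vertices broken, everything the step reads is constant on [cyl A], and
    so is the next state. *)
Lemma known_next : known n.+1 A t0 [::] (sfm_state X n.+1 t0).2 [::].
Proof.
have nwE := newly_born Wf rk; rewrite s2 in nwE.
have stE t : cyl A t -> sfm_state X n.+1 t = sfm_state X n.+1 t0.
  move=> At; rewrite !state_succ (kn_state K At) -/s sE.
  apply/esym; apply: same_step.
  - by move=> a al; exact: (known_moved_same K At).
  - by move=> z /tied zZ; have [_ _ zt] := kn_tied K zZ; apply/esym; apply: zt; exact: At.
  - move=> z; rewrite -sE nwE => zb; apply/esym; apply: (kn_born K zb); exact: At.
have sub z : z \notin (sfm_state X n.+1 t0).1 -> z \notin s.1 /\ z \notin born (walks t0) s.1 l1.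
  by rewrite state_succ mem_cat nwE negb_or => /andP[].
split => //.
- exact: (kn_adapted K).
- exact: (kn_in K).
- move=> t At; rewrite !visits_succ (kn_visits K At) (kn_state K At) -/s.
  rewrite sE (same_arrivals (w' := walks t))//; exact: (known_moved_same K At).
- by move=> f t; exact: (kn_start K).
- move=> a; rewrite state_succ mem_cat => /orP[/mapP[b]|].
    rewrite mem_filter => /andP[_ bs] -> /=; apply: (kn_moved K).
    by move: bs; rewrite s2.
  case/allpairsPdep => v [i [vn _ ->]] /=.
  have vs : v \notin s.1 by move: vn; rewrite mem_undup mem_filter => /andP[].
  rewrite (kn_asleep K)//; apply/seteqP; split => t /= => [h [|//] _|h].
    by rewrite h w0.
  by rewrite h// w0.
- by move=> f /sub[fs _]; exact: (kn_asleep K).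
- by move=> z /sub[zs zb] _; exact: (kn_unborn K).
- move=> z m /sub[zs zb] _; apply: (kn_untied K) => //.
  by apply/negP => zZ; have [zb'] := kn_tied K zZ; rewrite zb' in zb.
- by rewrite state_succ; exact: wf_step.
Qed.

End NextStep.

End Link.

(** * Induction over the steps of the process *)

Section Induction.
Context (R : realType) (d : nat) (p : R) (nu : probability nat R)
  (dT : measure_display) (T : measurableType dT) (P : probability T R).
Variable X : SFM d p nu P.
Hypothesis (p_gt0 : 0 < p) (p_lt_half : p < 2^-1) (d_ge2 : (2 <= d)%N).

(** [Phi k] bounds the conditional probability of [Ev] when k steps remain; it is [bestE] with
    horizon k for the lower bound and [supE] for all k for the upper one. *)
Variables (b : bool) (Phi : nat -> config -> \bar R) (m N : nat).
Let Ev := [set t | (m <= visits_before X N t)%N].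
Hypothesis mE : measurable Ev.
Hypothesis Phi_ge0 : forall k, nonneg (Phi k).
Hypothesis Phi0 : forall c, cmp b (if (m <= visits c)%N then 1%E else 0%E) (Phi 0 c).
Hypothesis PhiS : forall k V L n, ready d L (bare V n) ->
  cmp b (sweepE nu p d L (Phi k) (@bare d V n)) (Phi k.+1 (adds L (bare V n))).

Local Notation W := (walks X).
Local Notation E := (sleeping X).
Local Notation K := (ranks X).
Local Notation S := (sfm_state X).

Implicit Type A : source d -> set T.

Lemma cmp_empty A V : (forall t, ~ cyl A t) -> cmp b (P (cyl A `&` Ev)) (P (cyl A) * V)%E.
Proof.
move=> A0; rewrite (_ : cyl A = set0); last by apply/seteqP; split => t // /A0.
by rewrite set0I measure0 mul0e; exact: cmp_refl.
Qed.

Lemma cmp_mul (x y z : \bar R) : (0 <= x)%E -> cmp b y z -> cmp b (x * y)%E (x * z)%E.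
Proof. by move=> x0; case: b => h; apply: lee_wpmul2l. Qed.

Definition claim (n k : nat) : Prop := forall A t0,
  known X n A t0 [::] (S n t0).2 [::] ->
  cmp b (P (cyl A `&` Ev))
    (P (cyl A) * Phi k (adds (map (ptype (W t0)) (S n t0).2)
                          (bare (S n t0).1 (visits_before X n t0))))%E.

Definition mid_config n t0 l : config :=
  midway (E t0) (W t0) (S n t0).1 (visits_before X n t0) l.

Lemma mid_config_rebase n A t0 l1 l2 Z t1 : known X n A t0 l1 l2 Z -> cyl A t1 ->
  mid_config n t1 l1 = mid_config n t0 l1.
Proof.
move=> Kn At1; rewrite /mid_config (kn_state Kn At1) (kn_visits Kn At1).
apply/esym; apply: same_midway; first exact: (known_moved_same Kn At1).
by move=> z zb; apply/esym; apply: (kn_born Kn zb); exact: At1.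
Qed.

(** The next state is determined only once the ties are revealed, but [mid_config] does not depend
    on them, so averaging over the ranks changes nothing. *)
Lemma claim_ties n k : claim n.+1 k -> forall (zs : seq (vertex d)) A t0 l1 Z,
  known X n A t0 l1 [::] Z ->
  (forall z, z \in born (W t0) (S n t0).1 l1 -> z \in zs \/ z \in Z) ->
  cmp b (P (cyl A `&` Ev)) (P (cyl A) * Phi k (mid_config n t0 l1))%E.
Proof.
move=> hk; elim=> [|z zs IH] A t0 l1 Z Kn cov.
  have tied z : z \in born (W t0) (S n t0).1 l1 -> z \in Z by case/cov.
  by rewrite /mid_config (midway_next Kn tied); apply: hk; exact: (known_next Kn tied).
have [zb|zb] := boolP (z \in born (W t0) (S n t0).1 l1); last first.
  apply: IH Kn _ => z' zb'; case: (cov _ zb') => [|]; last by right.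
  by rewrite inE => /orP[/eqP zz|]; [move: zb; rewrite -zz zb'|left].
have [zZ|zZ] := boolP (z \in Z).
  apply: IH Kn _ => z' /cov[|]; last by right.
  by rewrite inE => /orP[/eqP ->|]; [right|left].
pose M := size (contenders (W t0) ((S n t0).1, l1) z).
have M0 : (0 < M)%N.
  have /[1!mem_born]/andP[zs' /mapP[a]] := zb.
  rewrite mem_filter => /andP[na al] zE.
  by rewrite -has_predT; apply/hasP; exists a => //; rewrite mem_filter na zE eqxx.
have MR : (M%:R : R) != 0 by rewrite pnatr_eq0 -lt0n.
have M1 : \sum_(r <- iota 0 M) (M%:R^-1 : R) = 1.
  by rewrite big_const_seq count_predT size_iota iter_addr_0 -[LHS]mulr_natl divff.
have -> : Phi k (mid_config n t0 l1) =
    (\sum_(r <- iota 0 M) (M%:R^-1)%:E * Phi k (mid_config n t0 l1))%E.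
  rewrite -ge0_sume_distrl; last by move=> i _; rewrite lee_fin invr_ge0.
  by rewrite sumEFin M1 mul1e.
have zS : z \notin (S n t0).1 by move: zb; rewrite mem_born => /andP[].
apply: (@reveal_finite _ _ _ _ _ _ _ X b A (Tie z M) _ (fun t => K t z M) (iota 0 M)
  (fun=> M%:R^-1) (fun=> Phi k (mid_config n t0 l1))).
- exact: (kn_adapted Kn).
- by move=> r; exact: sigma_tie.
- exact: iota_uniq.
- by move=> _; rewrite invr_ge0.
- move=> r; rewrite mem_iota => rM.
  rewrite (kn_untied Kn _ zS zZ) setTI probability_setT mul1e.
  exact: (tie_law X z rM).
- exact: M1.
- exact: mE.
- by move=> _; exact: Phi_ge0.
move=> r; rewrite mem_iota => /= rM; set A' := refine _ _ _.
(* An empty event satisfies either inequality; any point of a nonempty one serves as the new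
   reference point. *)
have [[t1 At1]|] := pselect (exists t, cyl A' t); last first.
  by move=> nA; apply: cmp_empty => t At; apply: nA; exists t.
have [At1' Kr] : cyl A t1 /\ K t1 z M = r by move: At1; rewrite cyl_refine => -[].
have st := kn_state Kn At1'.
have sm := known_moved_same Kn At1'.
have Kn1 := known_rebase Kn At1'.
have ME : size (contenders (W t1) ((S n t1).1, l1) z) = M.
  by rewrite st -(same_contenders sm).
have bE : born (W t1) (S n t1).1 l1 = born (W t0) (S n t0).1 l1.
  by rewrite st -(same_born sm).
rewrite -(mid_config_rebase Kn At1').
have Kn2 := @known_tie _ _ _ _ _ _ _ X n A t1 l1 Z z Kn1.
rewrite /= ME bE Kr in Kn2.
apply: IH (Kn2 zb rM) _ => z'; rewrite bE => /cov[|zZ']; last first.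
  by right; rewrite inE zZ' orbT.
by rewrite !inE => /orP[->|]; [right|left].
Qed.

(** The next step of each unmoved particle is revealed in list order, along with the sleepers of a
    vertex that it opens; this is the recursion of [sweepE]. *)
Lemma claim_sweep n k : claim n.+1 k -> forall l2 l1 A t0, known X n A t0 l1 l2 [::] ->
  cmp b (P (cyl A `&` Ev))
   (P (cyl A) * sweepE nu p d (map (ptype (W t0)) l2) (Phi k) (mid_config n t0 l1))%E.
Proof.
move=> hk; elim=> [|a l2 IH] l1 A t0 Kn /=.
  by apply: (claim_ties hk (zs := born (W t0) (S n t0).1 l1) Kn) => z; left.
set F := sweepE _ _ _ _ _.
have F0 : nonneg F by apply: sweepE_ge0.
have ain : a \in a :: l2 by rewrite inE eqxx.
have as2 : a \in (S n t0).2 by rewrite (kn_split Kn) mem_cat ain orbT.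
pose v := position (W t0) a; pose pr := prev_position (W t0) a.
have mov : pr -> v != Defs.root by exact: (wf_moving (kn_wf Kn)).
rewrite (moveE_neighbours nu p mov).
apply: (@reveal_finite _ _ _ _ _ _ _ X b A (Walk a.1) _ (fun t => W t a.1 a.2.+1)
  (neighbours v) (step_prob p pr v)
  (fun y => eventE nu (neighbour_event v y) F (mid_config n t0 l1))).
- exact: (kn_adapted Kn).
- by move=> y; exact: sigma_walk.
- exact: uniq_neighbours.
- by move=> y; exact: step_prob_ge0.
- by move=> y _; apply: P_walk; rewrite (kn_unmoved Kn ain).
- exact: sum_step_prob.
- exact: mE.
- by move=> y; exact: eventE_ge0.
move=> y yv /=; set A1 := refine _ _ _.
have [[t1 At1]|] := pselect (exists t, cyl A1 t); last first.
  by move=> nA; apply: cmp_empty => t At; apply: nA; exists t.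
have [At1' yE] : cyl A t1 /\ W t1 a.1 a.2.+1 = y by move: At1; rewrite cyl_refine => -[].
have aA1 : adapted X A1 by apply: adapted_refine; [exact: (kn_adapted Kn)|exact: sigma_walk].
have Kn1 := known_rebase Kn At1'.
have sm2 := known_unmoved_same Kn At1'.
rewrite -(mid_config_rebase Kn At1').
have FE : F = sweepE nu p d (map (ptype (W t1)) l2) (Phi k).
  rewrite /F; congr (sweepE nu p d _ _).
  by apply/eq_in_map => c cl; apply: same_ptype; apply: sm2; rewrite inE cl orbT.
have vE : v = position (W t1) a by apply: same_position; exact: sm2.
have tE : target (W t1) a = y := yE.
rewrite {}FE.
have nb1 : target (W t1) a \in neighbours (position (W t1) a) by rewrite tE -vE.
have sub1 t : cyl A1 t -> cyl A t by rewrite cyl_refine => -[].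
have mr t2 : target (W t2) a = y -> position (W t2) a = v ->
    mid_config n t2 (rcons l1 a) =
    if y == parent v then
      if y == Defs.root then add_visit (mid_config n t2 l1)
      else add_particles 1 (Some (emb v), emb y) (mid_config n t2 l1)
    else if y \in born (W t2) (S n t2).1 l1 ++ (S n t2).1 then mid_config n t2 l1
    else open_at (emb y) (E t2 y) (mid_config n t2 l1).
  move=> ty pv; rewrite /mid_config midway_rcons ty pv//.
have visE t2 : visited (mid_config n t2 l1) (emb y) =
    (y \in born (W t2) (S n t2).1 l1 ++ (S n t2).1).
  by rewrite /mid_config /midway visited_adds /= mem_map//; exact: emb_inj.
have old : (y \in born (W t1) (S n t1).1 l1 ++ (S n t1).1) || (y == parent v) ->
    known X n A1 t1 (rcons l1 a) l2 [::].
  move=> yo; apply: (known_move Kn1) => //.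
  - by move=> f; rewrite tE.
  - by move=> z; left.
  - move: yo => /orP[yo|yo]; first by rewrite tE; left.
    by right; left; rewrite /inward tE -vE.
rewrite /neighbour_event; case: ifPn => [yp|yp].
  have K2 := IH _ _ _ (old _); rewrite yp orbT in K2.
  have := K2 isT; rewrite mr// yp /parent_event behead_emb emb_root -(eqP yp).
  by case: (y == Defs.root).
have [yo|yn] := boolP (y \in born (W t1) (S n t1).1 l1 ++ (S n t1).1).
  rewrite /= visE yo.
  have K2 := IH _ _ _ (old _); rewrite yo in K2.
  by have := K2 isT; rewrite mr// (negbTE yp) yo.
rewrite /= visE (negbTE yn).
have ys : y \notin (S n t1).1 by move: yn; rewrite mem_cat negb_or => /andP[].
have yb : y \notin born (W t1) (S n t1).1 l1 by move: yn; rewrite mem_cat negb_or => /andP[].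
have A1y : A1 (Sleepers y) = setT by exact: (kn_unborn Kn1 ys yb).
apply: (@reveal_nat _ _ _ _ _ _ _ X b A1 (Sleepers y) (fun t => E t y)).
- exact: aA1.
- by move=> e; exact: sigma_sleepers.
- move=> e; rewrite A1y setTI probability_setT mul1e; exact: (sleepers_law X y [set e]).
- exact: mE.
- by move=> e; apply: sweepE_ge0.
move=> e /=; set A2 := refine _ _ _.
have [[t2 At2]|] := pselect (exists t, cyl A2 t); last first.
  by move=> nA; apply: cmp_empty => t At; apply: nA; exists t.
have [At2' eE] : cyl A1 t2 /\ E t2 y = e by move: At2; rewrite cyl_refine => -[].
have At2'' := sub1 _ At2'.
have Kn2 := known_rebase Kn1 At2''.
have sm3 := known_unmoved_same Kn1 At2''.
have bE : born (W t2) (S n t2).1 l1 = born (W t1) (S n t1).1 l1.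
  by rewrite (kn_state Kn1 At2'') -(same_born (known_moved_same Kn1 At2'')).
have yE2 : W t2 a.1 a.2.+1 = y by move: At2'; rewrite cyl_refine => -[].
have tE2 : target (W t2) a = y := yE2.
have vE2 : position (W t2) a = v.
  by rewrite vE; apply/esym; apply: same_position; apply: sm3.
have K3 : known X n A2 t2 (rcons l1 a) l2 [::].
  apply: (known_move Kn2) => //.
  - by rewrite tE2 vE2.
  - by apply: adapted_refine; [exact: aA1|exact: sigma_sleepers].
  - by move=> t; rewrite cyl_refine => -[/sub1].
  - by move=> f; rewrite tE2.
  - move=> z; rewrite /A2 /refine; case: eqP => [[->]|_]; last by left.
    right; rewrite tE2; split => //; last by move=> t [_ /= ->].
    rewrite mem_born (kn_state Kn1 At2'') ys /outs filter_rcons.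
    rewrite /inward tE2 vE2 (negbTE yp) /= map_rcons mem_rcons inE -/(target _ _).
    by rewrite tE2 eqxx.
  - by right; right => t; rewrite tE2 /A2 /refine eqxx => -[_ /= ->].
have := IH _ _ _ K3; rewrite mr// (negbTE yp) bE.
rewrite (kn_state Kn1 At2'') (negbTE yn) eE (mid_config_rebase Kn1 At2'').
have -> // : map (ptype (W t2)) l2 = map (ptype (W t1)) l2.
apply/eq_in_map => c cl; apply/esym; apply: same_ptype; apply: sm3.
by rewrite inE cl orbT.
Qed.

Lemma claim_all k n : (n + k)%N = N -> claim n k.
Proof.
elim: k n => [|k IH] n nk A t0 Kn.
  rewrite addn0 in nk; set c := adds _ _.
  apply: (@cmp_trans _ b _ (P (cyl A) * (if (m <= visits c)%N then 1 else 0))%E).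
    (* With no step left the number of visits is constant on [cyl A], which [Ev] thus contains or
       misses altogether. *)
    rewrite visits_adds /=; case: ifPn => h.
      rewrite mule1 (_ : cyl A `&` Ev = cyl A); first exact: cmp_refl.
      apply/seteqP; split => [t []//|t At]; split => //.
      by rewrite /Ev /= -nk (kn_visits Kn At).
    rewrite mule0 (_ : cyl A `&` Ev = set0); first by rewrite measure0; exact: cmp_refl.
    apply/seteqP; split => [t [At]|t []//]; rewrite /Ev /= -nk (kn_visits Kn At).
    by apply/negP.
  by apply: cmp_mul => //; exact: Phi0.
have h := @claim_sweep n k (IH n.+1 _); rewrite addSnnS in h.
apply: cmp_trans (h nk _ _ _ _ Kn) _; apply: cmp_mul => //.
rewrite /mid_config /midway /= addn0; apply: PhiS.
by apply: wf_ready; exact: (kn_wf Kn).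
Qed.

Definition start_info (s : source d) : set T :=
  if s is Walk f then [set t | W t f 0%N = f.1] else setT.

Lemma P_start f : P [set t | W t f 0%N = f.1] = 1%E.
Proof.
rewrite (_ : mkset _ = [set t | forall k, (k <= 0)%N -> walk X f k t = (fun=> f.1) k]).
  have := @walk_law _ _ _ _ _ _ _ X f (fun=> f.1) 0%N; rewrite /= => ->.
  by rewrite /walk_prob eqxx big_geq// mul1r.
by apply/seteqP; split => t /= => [h [|]//|]; apply.
Qed.

Lemma adapted_start : adapted X start_info.
Proof.
split=> [[v|f|x r]|]; [exact: sigma_setT|exact: sigma_walk|exact: sigma_setT|].
by exists [::] => -[v|f|x r] _ /=; rewrite ?P_start//; exact: probability_setT.
Qed.

Lemma known_start t0 : cyl start_info t0 ->
  known X 0 start_info t0 [::] [:: ((Defs.root, 0%N), 0%N)] [::].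
Proof.
move=> At0; have w0 f : W t0 f 0%N = f.1 by exact: (At0 (Walk f)).
split => //.
- exact: adapted_start.
- by move=> t _; rewrite /visits_before !big_ord0.
- move=> a /[1!inE] /eqP -> /=.
  apply/seteqP; split => t /= => [h [|//] _|h]; first by rewrite h w0.
  by rewrite h// w0.
- split => //=.
  + by move=> v /[1!inE] /eqP ->; rewrite inE.
  + by move=> a /[1!inE] /eqP ->; rewrite inE.
  + by move=> a /[1!inE] /eqP ->; rewrite /position w0 inE.
  + by move=> a v /[1!inE] /eqP ->.
  + by move=> a /[1!inE] /eqP ->.
  + move=> [|x L1] v L2; rewrite /ptype /emb_particle /= /position w0 /=.
      by move=> [<- _]; exact: Or31.
    by move=> [_]; case: L1.
Qed.

Theorem link :
  cmp b (P Ev) (Phi N (adds [:: (None, [::])] (@bare d [:: Defs.root] 0))).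
Proof.
have P1 : P (cyl start_info) = 1%E.
  rewrite (@P_cyl _ _ _ _ _ _ _ X start_info [::]) ?big_nil//; first exact: adapted_start.
  by move=> [v|f|x r] _ /=; rewrite ?P_start//; exact: probability_setT.
have mC : measurable (cyl start_info) by apply: measurable_cyl; exact: adapted_start.
have [[t0 At0]|nA] := pselect (exists t, cyl start_info t); last first.
  move: P1; rewrite (_ : cyl _ = set0) ?measure0; first by move=> /esym/eqP; rewrite onee_eq0.
  by apply/seteqP; split => t // At; apply: nA; exists t.
have := claim_all (add0n N) (known_start At0).
rewrite P1 mul1e /visits_before big_ord0 /=.
have -> : ptype (W t0) ((Defs.root, 0%N), 0%N) = (None, [::]).
  by rewrite /ptype /emb_particle /= /position (At0 (Walk _)).
suff -> : P (cyl start_info `&` Ev) = P Ev by [].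
rewrite setIC [RHS](measureDI P mE mC).
rewrite [X in (X + _)%E](_ : _ = 0%E) ?add0e//.
apply: (@subset_measure0 _ _ _ P _ (~` cyl start_info)).
- exact: measurableD.
- exact: measurableC.
- by move=> t [].
- by have := probability_setC P mC; rewrite P1 subee.
Qed.

End Induction.

(** * Measurability of the number of visits *)

(** The preimage is the union of the cylinders that it contains, and there are only countably many
    of them. *)
Lemma measurable_local (dT : measure_display) (T : measurableType dT)
    (I C : countType) (C' : Type) (xi : I -> T -> C) (f : T -> C') :
  (forall i c, measurable [set t | xi i t = c]) ->
  (forall t, exists J : seq I, forall t', map (xi^~ t') J = map (xi^~ t) J -> f t' = f t) ->
  forall B : set C', measurable (f @^-1` B).
Proof.
move=> mxi loc B.
pose cylinder (Jc : seq I * seq C) := [set t | map (xi^~ t) Jc.1 = Jc.2].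
have mcyl Jc : measurable (cylinder Jc).
  case: Jc => J; rewrite /cylinder /=; elim: J => [|i J IH] [|c cs].
  - by rewrite (_ : mkset _ = setT)//; apply/seteqP; split.
  - by rewrite (_ : mkset _ = set0)//; apply/seteqP; split.
  - by rewrite (_ : mkset _ = set0)//; apply/seteqP; split.
  rewrite (_ : mkset _ = [set t | xi i t = c] `&` [set t | map (xi^~ t) J = cs]).
    by apply: measurableI; [exact: mxi|exact: IH].
  by apply/seteqP; split => t /= => [[-> ->]|[-> ->]].
rewrite (_ : f @^-1` B = \bigcup_(Jc in [set: seq I * seq C])
    if `[< cylinder Jc `<=` f @^-1` B >] then cylinder Jc else set0).
  apply: countable_bigcupT_measurable => [|Jc]; first exact: countableP.
  by case: ifP.
apply/seteqP; split => [t Bt|t [Jc _]]; last by case: asboolP => // h /h.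
have [J ft] := loc t; exists (J, map (xi^~ t) J) => //.
by case: asboolP => // -[]; move=> t' /ft /= ->.
Qed.

Section VisitsMeasurable.
Context (R : realType) (d : nat) (p : R) (nu : probability nat R)
  (dT : measure_display) (T : measurableType dT) (P : probability T R).
Variable X : SFM d p nu P.

Definition coordinate : Type := ((frog d * nat) + (vertex d + vertex d * nat))%type.

Definition coordinate_value (i : coordinate) (t : T) : vertex d + nat :=
  match i with
  | inl (f, k) => inl (walk X f k t)
  | inr (inl v) => inr (sleepers X v t)
  | inr (inr (x, r)) => inr (tie X x r t)
  end.

Lemma measurable_coordinate i c : measurable [set t | coordinate_value i t = c].
Proof.
case: i c => [[f k]|[v|[x r]]] [c|c] /=;
  do ?[by rewrite (_ : mkset _ = set0)//; apply/seteqP; split].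
- rewrite (_ : mkset _ = [set t | walk X f k t = c]).
    exact: (sigma_measurable (@sigma_walk _ _ _ _ _ _ _ X f k c)).
  by apply/seteqP; split => t /= => [[]|->].
- rewrite (_ : mkset _ = [set t | sleepers X v t = c]).
    exact: (sigma_measurable (@sigma_sleepers _ _ _ _ _ _ _ X v c)).
  by apply/seteqP; split => t /= => [[]|->].
- rewrite (_ : mkset _ = [set t | tie X x r t = c]).
    exact: (sigma_measurable (@sigma_tie _ _ _ _ _ _ _ X x r c)).
  by apply/seteqP; split => t /= => [[]|->].
Qed.

Lemma state_local n t : exists J : seq coordinate, forall t',
  map (coordinate_value^~ t') J = map (coordinate_value^~ t) J ->
  sfm_state X n t' = sfm_state X n t /\ visits_before X n t' = visits_before X n t.
Proof.
elim: n => [|n [J hJ]].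
  by exists [::] => t' _; rewrite /visits_before !big_ord0.
pose s := sfm_state X n t; pose w := walks X t.
pose J1 : seq coordinate := [seq inl (a.1, i) | a <- s.2, i <- iota 0 a.2.+2].
pose J2 : seq coordinate :=
  [seq inr (inr (z, size (contenders w s z))) | z <- born w s.1 s.2].
pose J3 : seq coordinate := [seq inr (inl z) | z <- newly_visited w (ranks X t) s].
exists (J ++ J1 ++ J2 ++ J3) => t' /eq_in_map eqJ.
have [st vt] : sfm_state X n t' = s /\ visits_before X n t' = visits_before X n t.
  by apply: hJ; apply/eq_in_map => i iJ; apply: eqJ; rewrite mem_cat iJ.
have sE : s = (s.1, s.2) by case: (s).
have sm a : a \in s.2 -> same_path w (walks X t') a.1 a.2.+1.
  move=> a2 i ik; have : (inl (a.1, i) : coordinate) \in J1.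
    by apply/allpairsPdep; exists a, i; rewrite mem_iota.
  move=> iJ; have := eqJ (inl (a.1, i)); rewrite !mem_cat iJ orbT => /(_ isT) /= [] h.
  exact: esym h.
split; last first.
  rewrite !visits_succ vt st -/s sE; congr (_ + _)%N.
  by apply/esym; exact: same_arrivals.
rewrite !state_succ st -/s [in LHS]sE [in RHS]sE; apply/esym; apply: same_step => //.
- move=> z zb; rewrite -sE.
  have iJ : (inr (inr (z, size (contenders w s z))) : coordinate) \in J2 by exact: map_f.
  have := eqJ (inr (inr (z, size (contenders w s z)))).
  by rewrite !mem_cat iJ !orbT => /(_ isT) /= [] h; exact: esym h.
- move=> z; rewrite -sE => zn.
  have iJ : (inr (inl z) : coordinate) \in J3 by exact: map_f.
  have := eqJ (inr (inl z)).
  by rewrite !mem_cat iJ !orbT => /(_ isT) /= [] h; exact: esym h.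
Qed.

Lemma measurable_visits_before n (B : set nat) :
  measurable [set t | B (visits_before X n t)].
Proof.
apply: (measurable_local (f := visits_before X n) measurable_coordinate) => t.
by have [J hJ] := state_local n t; exists J => t' /hJ[].
Qed.

End VisitsMeasurable.

(** * Quantile coupling *)

Section NatSeries.
Context (R : realType) (f : nat -> nat).
Local Open Scope ereal_scope.

Let V : \bar R := \sum_(0 <= n <oo) (f n)%:R%:E.
Let S (N : nat) : nat := \sum_(0 <= i < N) f i.

Let partialE N : \sum_(0 <= i < N) (f i)%:R%:E = (S N)%:R%:E :> \bar R.
Proof. by rewrite sumEFin /S natr_sum. Qed.

Let partial_le N : (S N)%:R%:E <= V.
Proof. by rewrite -partialE; apply: nneseries_lim_ge => n _ _; rewrite lee_fin. Qed.

Let series_le (x : \bar R) : (forall N, (S N)%:R%:E <= x) -> V <= x.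
Proof.
move=> h; apply: lime_le; first by apply: is_cvg_nneseries => n _ _; rewrite lee_fin.
by apply: nearW => N; rewrite partialE.
Qed.

(** The partial sums are integers, so an integer bound on the limit is attained at a finite
    stage. *)
Lemma nat_series_ge m : m%:R%:E <= V <-> exists N, (m <= S N)%N.
Proof.
split=> [mV|[N mS]]; last by apply: le_trans (partial_le N); rewrite lee_fin ler_nat.
apply: contrapT => nS; case: m mV nS => [|m] mV nS; first by apply: nS; exists 0%N.
have : V <= m%:R%:E.
  apply: series_le => N; rewrite lee_fin ler_nat leqNgt; apply/negP => h.
  by apply: nS; exists N.
by move=> /(le_trans mV); rewrite lee_fin ler_nat ltnn.
Qed.

Lemma nat_series_value : V = +oo \/ exists n, V = n%:R%:E.
Proof.
have [[M hM]|nb] := pselect (exists M, forall N, (S N <= M)%N); [right|left].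
  pose Q k := `[< exists N, S N = k >].
  have exQ : exists k, Q k by exists (S 0); apply/asboolP; exists 0%N.
  have ubQ k : Q k -> (k <= M)%N by move=> /asboolP[N <-].
  case: (ex_maxnP exQ ubQ) => k /asboolP[N Nk] kmax.
  exists k; apply/eqP; rewrite eq_le -{2}Nk partial_le andbT.
  apply: series_le => N'; rewrite lee_fin ler_nat; apply: kmax.
  by apply/asboolP; exists N'.
apply/eqyP => r r0; have [M rM] : exists M : nat, (r <= M%:R)%R.
  exists (Num.truncn r).+1; exact: ltW (truncnS_gt r).
apply: (@le_trans _ _ M%:R%:E); first by rewrite lee_fin.
apply/nat_series_ge; apply: contrapT => h; apply: nb; exists M => N.
by rewrite leqNgt; apply/negP => MN; apply: h; exists N; exact: ltnW.
Qed.

End NatSeries.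

Section Law.
Context (R : realType) (dT : measure_display) (T : measurableType dT)
  (P : probability T R) (X : {RV P >-> \bar R}).
Hypothesis nat_valued : forall t, X t = +oo%E \/ exists n : nat, X t = n%:R%:E.
Local Open Scope ereal_scope.

Definition mass n : \bar R := P [set t | X t = n%:R%:E].

Let mpt x : measurable [set t | X t = x].
Proof.
rewrite -[X in measurable X]setTI.
exact: (measurable_funPT X measurableT _ (emeasurable_set1 x)).
Qed.

Lemma distribution_nat B : measurable B -> distribution P X B =
  \sum_(0 <= n <oo) (if n%:R%:E \in B then mass n else 0) +
  (if +oo \in B then P [set t | X t = +oo] else 0).
Proof.
move=> mB.
pose F n := if (n%:R%:E : \bar R) \in B then [set t | X t = n%:R%:E] else set0.
pose Fy := if (+oo : \bar R) \in B then [set t | X t = +oo] else set0.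
have mF n : measurable (F n) by rewrite /F; case: ifP.
have mFy : measurable Fy by rewrite /Fy; case: ifP.
have -> : distribution P X B = P (\bigcup_n F n `|` Fy).
  congr (P _); apply/seteqP; split => [t /= Bt|t [[n _]|]].
  - case: (nat_valued t) => [Xt|[n Xt]]; [right|left; exists n => //].
      by rewrite /Fy ifT// inE -Xt.
    by rewrite /F ifT// inE -Xt.
  - by rewrite /F; case: ifPn => //; rewrite inE /= => Bn ->.
  - by rewrite /Fy; case: ifPn => //; rewrite inE /= => By ->.
rewrite measureU//; last 2 first.
- exact: bigcupT_measurable.
- apply/seteqP; split => t // [[n _]]; rewrite /F /Fy.
  by case: ifP => // _; case: ifP => // _ /= ->.
congr (_ + _); last by rewrite /Fy; case: ifP => // _; rewrite measure0.
transitivity (\sum_(0 <= n <oo) P (F n)).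
  apply: measure_semi_bigcup => //; last exact: bigcupT_measurable.
  move=> i j _ _ [t []]; rewrite /F; case: ifP => // _; case: ifP => // _ /= -> [].
  by move=> /eqP; rewrite eqr_nat => /eqP.
by apply: eq_eseriesr => n _; rewrite /F /mass; case: ifP => // _; rewrite measure0.
Qed.

Lemma mass_tail n : mass n =
  P [set t | n%:R%:E <= X t] - P [set t | n.+1%:R%:E <= X t].
Proof.
have mt k : measurable [set t | (k%:R%:E <= X t)%E].
  rewrite -[X in measurable X]setTI; exact: emeasurable_fun_c_infty.
set A := [set t | n%:R%:E <= X t]; set B := [set t | n.+1%:R%:E <= X t].
have BA : A `&` B = B.
  apply/setIidPr => t; apply: le_trans; by rewrite lee_fin ler_nat.
have -> : mass n = P (A `\` B).
  congr (P _); apply/seteqP; split => [t /= Xt|t /= [nX /negP]].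
    by rewrite /A /B /= Xt; split => //; apply/negP; rewrite lee_fin ler_nat ltnn.
  case: (nat_valued t) => [->|[k Xk]]; first by rewrite leey.
  move: nX; rewrite /A /= Xk !lee_fin !ler_nat -ltnNge ltnS => h1 h2.
  by congr (_%:R%:E); apply/eqP; rewrite eqn_leq h2.
rewrite measureD; [by rewrite BA|exact: mt|exact: mt|].
by apply: (le_lt_trans _ (ltry 1)); exact: (probability_le1 P (mt n)).
Qed.

End Law.

(** Differences of tails give the masses at the integers; the mass at infinity is what remains of
    the total mass 1. *)
Lemma nat_distribution_eq (R : realType) (d1 d2 : measure_display)
    (T1 : measurableType d1) (T2 : measurableType d2)
    (P1 : probability T1 R) (P2 : probability T2 R)
    (X1 : {RV P1 >-> \bar R}) (X2 : {RV P2 >-> \bar R}) :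
  (forall t, X1 t = +oo%E \/ exists n : nat, X1 t = n%:R%:E) ->
  (forall t, X2 t = +oo%E \/ exists n : nat, X2 t = n%:R%:E) ->
  (forall m : nat, P1 [set t | (m%:R%:E <= X1 t)%E] = P2 [set t | (m%:R%:E <= X2 t)%E]) ->
  forall B, measurable B -> distribution P1 X1 B = distribution P2 X2 B.
Proof.
move=> n1 n2 tails B mB.
have massE n : mass X1 n = mass X2 n by rewrite !mass_tail// !tails.
rewrite !distribution_nat//; congr (_ + _)%E.
  by apply: eq_eseriesr => n _; rewrite massE.
case: ifP => // _.
have h1 := distribution_nat n1 measurableT.
have h2 := distribution_nat n2 measurableT.
have e1 : distribution P1 X1 setT = 1%E by exact: probability_setT.
have e2 : distribution P2 X2 setT = 1%E by exact: probability_setT.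
rewrite e1 in_setT in h1; rewrite e2 in_setT h1 in h2.
set S1 := (\sum_(0 <= n <oo) _)%E in h1 h2.
have SE : (\sum_(0 <= n <oo) (if (n%:R%:E : \bar R) \in setT then mass X2 n else 0) = S1)%E.
  by apply: eq_eseriesr => n _; rewrite massE.
rewrite SE in h2.
have S0 : (0 <= S1)%E by apply: nneseries_ge0 => n _ _; case: ifP => // _; exact: measure_ge0.
have S1f : S1 \is a fin_num.
  rewrite ge0_fin_numE//; apply: le_lt_trans (ltry 1); rewrite h1.
  by rewrite leeDl// measure_ge0.
by have := congr1 (fun x => x - S1)%E h2; rewrite ![(S1 + _)%E]addeC !addeK.
Qed.

Section Quantile.
Context (R : realType).
Local Open Scope ereal_scope.

(* If a m is the probability that X >= m.+1, this is the quantile function of X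
   read backwards. *)
Definition quantile (a : nat -> R) (u : measurableTypeR R) : \bar R :=
  \sum_(0 <= m <oo) ((u < a m)%R : nat)%:R%:E.

Lemma measurable_quantile a : measurable_fun [set: measurableTypeR R] (quantile a).
Proof.
apply: ge0_emeasurable_sum => [n t _ _|n _]; first by rewrite lee_fin.
apply/measurable_EFinP.
rewrite (_ : (fun u => _) = \1_[set u | (u < a n)%R]).
  by apply: measurable_indic; rewrite -set_itvNyo; exact: measurable_itv.
apply/funext => u; rewrite indicE; congr (_%:R).
by case: (ltP u (a n)) => h; [rewrite mem_set|rewrite memNset//= ltNge h].
Qed.

HB.instance Definition _ a :=
  isMeasurableFun.Build _ _ (measurableTypeR R) (\bar R) (quantile a) (measurable_quantile a).

Lemma quantile_nat a u : quantile a u = +oo \/ exists n : nat, quantile a u = n%:R%:E.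
Proof. exact: nat_series_value. Qed.

Lemma quantile_le a b u : (forall m, (a m <= b m)%R) -> quantile a u <= quantile b u.
Proof.
move=> ab; apply: lee_nneseries => m _; rewrite lee_fin ?ler0n// ler_nat.
by case: ltP => //= ua; rewrite (lt_le_trans ua (ab m)).
Qed.

(** As [a] is nonincreasing, the indices counted by [quantile a u] form an initial segment. *)
Lemma quantile_tail a u m : (forall i j, (i <= j)%N -> (a j <= a i)%R) ->
  (m.+1%:R%:E <= quantile a u) <-> (u < a m)%R.
Proof.
move=> anti; rewrite nat_series_ge; split=> [[N mN]|um].
  rewrite ltNge; apply/negP => au.
  have : (\sum_(0 <= i < N) (u < a i)%R <= m)%N.
    have count_lt : (\sum_(0 <= i < N) (i < m) = minn N m)%N.
      elim: N {mN} => [|N IH]; first by rewrite big_nil min0n.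
      by rewrite big_nat_recr// IH /=; case: (ltnP N m); lia.
    apply: leq_trans (geq_minr N m); rewrite -count_lt; apply: leq_sum => i _.
    case: (ltnP i m) => mi; first exact: leq_b1.
    by rewrite ltNge (le_trans (anti _ _ mi) au).
  by rewrite leqNgt mN.
exists m.+1; rewrite big_nat (eq_bigr (fun=> 1%N)); last first.
  by move=> i /andP[_ im]; rewrite (lt_le_trans um)// anti.
by rewrite -big_nat sum_nat_const_nat subn0 muln1.
Qed.

Lemma uniform_lt (r : R) : (0 <= r <= 1)%R ->
  uniform_prob (@ltr01 R) [set u | (u < r)%R] = r%:E.
Proof.
move=> /andP[r0 r1]; rewrite /uniform_prob integral_uniform_pdf.
rewrite (_ : _ `&` _ = `[0%R, r[%classic); last first.
  apply/seteqP; split => u /=; rewrite !in_itv/=.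
    by move=> [ur /andP[-> _]].
  by move=> /andP[-> ur]; split => //; rewrite (le_trans (ltW ur)).
rewrite (eq_integral (cst 1)); last first.
  move=> u; rewrite inE /= in_itv/= => /andP[u0 ur].
  by rewrite /uniform_pdf u0 (le_trans (ltW ur))// subr0 invr1.
rewrite integral_cst//= mul1e lebesgue_measure_itv/= lte_fin.
case: ltP => [_|r0']; first by rewrite -EFinD subr0.
by congr (_%:E); apply/eqP; rewrite eq_le r0 r0'.
Qed.

End Quantile.

Section Coupling.
Context (R : realType) (d1 d2 : measure_display)
  (T1 : measurableType d1) (T2 : measurableType d2)
  (P1 : probability T1 R) (P2 : probability T2 R).
Local Open Scope ereal_scope.

Definition tail d (T : measurableType d) (P : probability T R) (X : {RV P >-> \bar R})
  (m : nat) : R := fine (P [set t | m.+1%:R%:E <= X t]).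

Lemma measurable_tail d (T : measurableType d) (P : probability T R)
  (X : {RV P >-> \bar R}) (x : \bar R) : measurable [set t | x <= X t].
Proof. rewrite -[X in measurable X]setTI; exact: emeasurable_fun_c_infty. Qed.

Lemma tailE d (T : measurableType d) (P : probability T R) (X : {RV P >-> \bar R}) m :
  P [set t | m.+1%:R%:E <= X t] = (tail X m)%:E.
Proof. by rewrite fineK// fin_num_measure//; exact: measurable_tail. Qed.

Lemma quantile_distribution d (T : measurableType d) (P : probability T R)
    (X : {RV P >-> \bar R}) :
  (forall t, X t = +oo \/ exists n : nat, X t = n%:R%:E) ->
  forall B, measurable B ->
  distribution (uniform_prob (@ltr01 R)) (quantile (tail X)) B = distribution P X B.
Proof.
move=> nX; apply: nat_distribution_eq => //; first exact: quantile_nat.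
move=> [|m].
  rewrite (_ : mkset _ = setT); last first.
    by apply/seteqP; split => // u _ /=; apply: nneseries_ge0 => n _ _; rewrite lee_fin.
  rewrite [in RHS](_ : mkset _ = setT); last first.
    by apply/seteqP; split => // t _ /=; case: (nX t) => [->|[n ->]]; rewrite ?leey ?lee_fin.
  by rewrite !probability_setT.
rewrite [RHS]tailE (_ : mkset _ = [set u | (u < tail X m)%R]).
  apply: uniform_lt; rewrite -!lee_fin -tailE measure_ge0 /=.
  exact: (probability_le1 P (measurable_tail X _)).
have anti i j : (i <= j)%N -> (tail X j <= tail X i)%R.
  move=> ij; rewrite -lee_fin -!tailE; apply: le_measure; rewrite ?inE; try exact: measurable_tail.
  by move=> t /=; apply: le_trans; rewrite lee_fin ler_nat ltnS.
by apply/seteqP; split => u /=; rewrite quantile_tail.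
Qed.

Lemma stoch_le_tails (X : {RV P1 >-> \bar R}) (Y : {RV P2 >-> \bar R}) :
  (forall t, X t = +oo \/ exists n : nat, X t = n%:R%:E) ->
  (forall t, Y t = +oo \/ exists n : nat, Y t = n%:R%:E) ->
  (forall m : nat, P1 [set t | m%:R%:E <= X t] <= P2 [set t | m%:R%:E <= Y t]) ->
  stoch_le X Y.
Proof.
move=> nX nY h.
exists _, (measurableTypeR R), (uniform_prob (@ltr01 R)), (quantile (tail X)), (quantile (tail Y)).
split.
- exact: quantile_distribution.
- exact: quantile_distribution.
- apply: aeW => u; apply: quantile_le => m; rewrite -lee_fin -!tailE; exact: h.
Qed.

End Coupling.

(** * Conclusion *)

(** The root is the empty word in every degree, so both trees share this configuration. *)
Definition initial : config :=
  adds [:: (None, [::])] (Config (fun x => x \in [:: [::]]) (fun=> 0%N) 0).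

Section Tails.
Context (R : realType) (d : nat) (p : R) (nu : probability nat R)
  (dT : measure_display) (T : measurableType dT) (P : probability T R).
Variable X : SFM d p nu P.
Hypothesis (p_gt0 : 0 < p) (p_lt_half : p < 2^-1) (d_ge2 : (2 <= d)%N).
Local Open Scope ereal_scope.

Let early m N := [set t | (m <= visits_before X N t)%N].

Let measurable_early m N : measurable (early m N).
Proof. exact: (measurable_visits_before X N (fun k => (m <= k)%N)). Qed.

Let visits_beforeE N t : visits_before X N t = (\sum_(0 <= i < N) sfm_arrivals X i t)%N.
Proof. by rewrite /visits_before big_mkord. Qed.

Lemma V_SFM_ge m t : m%:R%:E <= V_SFM X t <-> exists N, early m N t.
Proof.
rewrite [V_SFM X t]/(root_visits X t) /root_visits nat_series_ge.
by split=> -[N h]; exists N; move: h; rewrite /early /= visits_beforeE.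
Qed.

Lemma V_SFM_nat t : V_SFM X t = +oo \/ exists n : nat, V_SFM X t = n%:R%:E.
Proof. exact: nat_series_value. Qed.

Let tail_bigcup m : [set t | m%:R%:E <= V_SFM X t] = \bigcup_N early m N.
Proof.
apply/seteqP; split => t /=; first by move=> /V_SFM_ge[N h]; exists N.
by move=> [N _ h]; apply/V_SFM_ge; exists N.
Qed.

Lemma supE_le_tail m : supE nu p d m initial <= P [set t | m%:R%:E <= V_SFM X t].
Proof.
apply: ub_ereal_sup => _ [N _ <-].
apply: (@le_trans _ _ (P (early m N))).
  apply: (@link _ _ _ _ _ _ _ X p_gt0 p_lt_half d_ge2 false (bestE nu p d m) m N).
  - exact: measurable_early.
  - by move=> k; exact: bestE_ge0.
  - by move=> c /=.
  - by move=> k V L n _; apply: bestE_sync.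
apply: le_measure; rewrite ?inE.
- exact: measurable_early.
- by rewrite tail_bigcup; apply: bigcupT_measurable => n; exact: measurable_early.
- by rewrite tail_bigcup => t h; exists N.
Qed.

(** The bound [supE] does not depend on the number of steps left, so it is uniform in the horizon
    and survives the limit. *)
Lemma tail_le_supE m : P [set t | m%:R%:E <= V_SFM X t] <= supE nu p d.+1 m initial.
Proof.
have cvgP : P \o early m @ \oo --> P (\bigcup_N early m N).
  apply: nondecreasing_cvg_mu.
  - by move=> N; exact: measurable_early.
  - by apply: bigcupT_measurable => n; exact: measurable_early.
  - move=> N N' NN'; apply/subsetPset => t; rewrite /early /= => /leq_trans; apply.
    by rewrite !visits_beforeE (big_cat_nat (leq0n N) NN') leq_addr.
rewrite tail_bigcup -(cvg_lim _ cvgP)//; apply: lime_le.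
  by apply/cvg_ex; eexists; exact: cvgP.
apply: nearW => N /=.
apply: (@link _ _ _ _ _ _ _ X p_gt0 p_lt_half d_ge2 true (fun=> supE nu p d.+1 m) m N).
- exact: measurable_early.
- by move=> k; exact: supE_ge0.
- by move=> c /=; exact: (bestE_supE nu p d.+1 m 0 c).
- by move=> k V L n; exact: sweepE_compare.
Qed.

End Tails.

Theorem theorem2 (R : realType) (p : R) (p_gt0 : 0 < p) (p_lt_half : p < 2^-1)
    (d : nat) (d_ge2 : (2 <= d)%N) (nu : probability nat R)
    (dT1 dT2 : measure_display)
    (T1 : measurableType dT1) (T2 : measurableType dT2)
    (P1 : probability T1 R) (P2 : probability T2 R)
    (X1 : SFM d p nu P1) (X2 : SFM d.+1 p nu P2) :
  stoch_le (V_SFM X1) (V_SFM X2).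
Proof.
apply: stoch_le_tails => [t|t|m]; [exact: V_SFM_nat|exact: V_SFM_nat|].
apply: le_trans (tail_le_supE X1 p_gt0 p_lt_half d_ge2 m) _.
by apply: supE_le_tail => //; exact: leqW.
Qed.
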